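(* Let $p\ge11$ be prime and let $\varepsilon=\omega^{-s_\varepsilon}\times\omega^{s_\varepsilon}$, $0\le s_\varepsilon\le p-2$. Fix an integer $k_0\ge2$ and put $$d=d_{k_0}^{\mathrm{Iw}}\bigl(\varepsilon(1\times\omega^{2-k_0})\bigr)=\left\lfloor\frac{k_0-2-s_\varepsilon}{p-1}\right\rfloor+1 .$$ Let $\varepsilon'=\varepsilon(\omega^{k_0-1}\times\omega^{1-k_0})=\omega^{-s_{\varepsilon'}}\times\omega^{s_{\varepsilon'}}$ with $s_{\varepsilon'}=\{s_\varepsilon+1-k_0\}$, and $\varepsilon''=\omega^{-s_{\varepsilon''}}\times\omega^{s_{\varepsilon''}}$ with $s_{\varepsilon''}=\{k_0-2-s_\varepsilon\}$. (1) For every $\ell\ge1$, the $(d+\ell)$-th slope of $\mathrm{NP}(G^{(\varepsilon)}(w_{k_0},-))$ is $k_0-1$ plus the $\ell$-th slope of $\mathrm{NP}(G^{(\varepsilon')}(w_{2-k_0},-))$. (2) If $k_0\not\equiv k_\varepsilon\pmod{p-1}$, then, for $1\le\ell\le d$, the sum of the $\ell$-th slope of $\mathrm{NP}(G^{(\varepsilon)}(w_{k_0},-))$ and the $(d-\ell+1)$-st slope of $\mathrm{NP}(G^{(\varepsilon'')}(w_{k_0},-))$ is $k_0-1$. (3) If $k_0\equiv k_\varepsilon\pmod{p-1}$, then $\varepsilon''=\varepsilon$, and the $\ell$-th and $(d-\ell+1)$-st slopes of $\mathrm{NP}(G^{(\varepsilon)}(w_{k_0},-))$ add to $k_0-1$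 for $1\le\ell\le d_{k_0}^{\mathrm{ur}}$. (4) If $k_0\equiv k_\varepsilon\pmod{p-1}$, then, for $0\le j\le d_{k_0}^{\mathrm{new}}$, $$v_p\bigl(g_{d_{k_0}^{\mathrm{Iw}}-d_{k_0}^{\mathrm{ur}}-j,\widehat{k_0}}(w_{k_0})\bigr)-v_p\bigl(g_{d_{k_0}^{\mathrm{ur}}+j,\widehat{k_0}}(w_{k_0})\bigr)=(k_0-2)\left(\frac{d_{k_0}^{\mathrm{new}}}2-j\right),$$ where $g_n=g_n^{(\varepsilon)}$. Thus the $d_{k_0}^{\mathrm{new}}$ slopes of $\mathrm{NP}(G^{(\varepsilon)}(w_{k_0},-))$ in the new interval $[d_{k_0}^{\mathrm{ur}},d_{k_0}^{\mathrm{Iw}}-d_{k_0}^{\mathrm{ur}}]$ are $(k_0-2)/2$.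
   Context: $v_p$ is the valuation on $\mathbb C_p$ with $v_p(p)=1$, $v_p(0)=+\infty$. $\omega$ is the Teichmüller character of $\mathbb F_p^\times$. $\{x\}\in\{0,\dots,p-2\}$ is the residue of the integer $x$ mod $p-1$. For any integer $k$, $w_k=\exp(p(k-2))-1$. $\mathrm{NP}(\sum F_nT^n)$ is the lower convex hull of the points $(n,v_p(F_n))$, $n\ge0$; its slopes are listed in nondecreasing order with multiplicity (the $\ell$-th slope is the slope over $[\ell-1,\ell]$). For each character $\chi=\omega^{-s_\chi}\times\omega^{s_\chi}$ with $0\le s_\chi\le p-2$ put $k_\chi=2+\{2s_\chi\}$, $\delta_\chi=\lfloor2s_\chi/(p-1)\rfloor$, $t_\chi=s_\chi+\delta_\chi+1$. For $k=k_\chi+(p-1)k_\bullet$, $k_\bullet\in\mathbb Z_{\ge0}$, put $$d_k^{\mathrm{Iw}}=k_\bullet+1-\delta_\chi=\Bigl\lfloor\frac{k-2-s_\chi}{p-1}\Bigr\rfloor+1,\qquad d_k^{\mathrm{ur}}=\Bigl\lfloor\frac{k_\bullet-t_\chi}{p+1}\Bigr\rfloor+1,\qquad d_k^{\mathrm{new}}=d_k^{\mathrm{Iw}}-2d_k^{\mathrm{ur}}$$ (the first two are the $\mathcal O$-ranks of the classical Iwahori-level and unramified spaces attached to a primitive projective-augmented module of très ramifiée type $\left(\begin{smallmatrix}\omega&*\\0&1\end{smallmatrix}\right)$; $d$ in the claim is likewise the rank of the weight-$k_0$ Iwahori space with character $\varepsilon(1\times\omega^{2-k_0})$). In parts (3),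 (4) these are taken for $\chi=\varepsilon$. Put $m_n(k)=\min\{n-d_k^{\mathrm{ur}},d_k^{\mathrm{Iw}}-d_k^{\mathrm{ur}}-n\}$ if $d_k^{\mathrm{ur}}<n<d_k^{\mathrm{Iw}}-d_k^{\mathrm{ur}}$ and $0$ otherwise, $g_n^{(\chi)}(w)=\prod_{k\equiv k_\chi(p-1),\,k\ge2}(w-w_k)^{m_n(k)}$ (a finite product), $g_0^{(\chi)}=1$, $g_{n,\widehat{k}}(w)=g_n(w)/(w-w_{k})^{m_n(k)}$, and $G^{(\chi)}(w,T)=1+\sum_{n\ge1}g_n^{(\chi)}(w)T^n$. *)

(* Defs.v *)
From HB Require Import structures.
From mathcomp Require Import all_boot all_order all_algebra.
From mathcomp Require Import all_classical all_reals all_analysis.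

Set Implicit Arguments.
Unset Strict Implicit.
Unset Printing Implicit Defensive.

Import Order.TTheory GRing.Theory Num.Theory.

Local Open Scope classical_set_scope.
Local Open Scope ring_scope.

(** * The valued field C_p *)

Definition vcvg (R : realType) (K : fieldType) (v : K -> \bar R)
    (u : nat -> K) (l : K) : Prop :=
  v (u n - l) @[n --> \oo] --> +oo%E.

Definition vcauchy (R : realType) (K : fieldType) (v : K -> \bar R)
    (u : nat -> K) : Prop :=
  forall M : R, exists N : nat, forall m n : nat,
    (N <= m)%N -> (N <= n)%N -> (M%:E <= v (u m - u n)%R)%E.

(* These properties characterize C_p (with v_p(p) = 1) up to isomorphism of
   valued fields: by completeness the closure of Q in K is Q_p, the algebraic
   elements form an algebraic closure of Q, and density makes K their
   completion. *)
Record is_Cp (p : nat) (R : realType) (K : closedFieldType)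
    (v : K -> \bar R) : Prop := IsCp {
  Cp_v0 : v 0 = +oo%E;
  Cp_vfin : forall x, x != 0 -> v x \is a fin_num;
  Cp_vM : forall x y, v (x * y) = (v x + v y)%E;
  Cp_vD : forall x y, (Order.min (v x) (v y) <= v (x + y)%R)%E;
  Cp_vp : v p%:R = 1%E;
  Cp_complete : forall u, vcauchy v u -> exists l, vcvg v u l;
  Cp_dense : forall (x : K) (M : R),
    exists2 y, algebraicOver (ratr : rat -> K) y & (M%:E <= v (x - y)%R)%E
}.

Definition vlim (R : realType) (K : fieldType) (v : K -> \bar R)
    (u : nat -> K) : K := xget 0 [set l | vcvg v u l].

Definition vexp (R : realType) (K : fieldType) (v : K -> \bar R) (x : K) : K :=
  vlim v (series (fun n => x ^+ n / n`!%:R)).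

(** * Characters of F_p^* x F_p^* *)

Definition teichmuller (p : nat) (R : realType) (K : fieldType)
    (v : K -> \bar R) (a : {unit 'F_p}) : K :=
  xget 0 [set z | z ^+ p.-1 = 1 /\ (0 < v (z - (val a : nat)%:R)%R)%E].

(* omega^i x omega^j *)
Definition omega_char (p : nat) (R : realType) (K : fieldType)
    (v : K -> \bar R) (i j : int) : {unit 'F_p} * {unit 'F_p} -> K :=
  fun a => teichmuller v a.1 ^ i * teichmuller v a.2 ^ j.
Arguments omega_char p {R K} v i j _.

(* A character chi = omega^(-s) x omega^s, 0 <= s <= p - 2, is determined by
   its exponent s = s_chi; the numerical data below are indexed by s. *)
Definition chi_of (p : nat) (R : realType) (K : fieldType)
    (v : K -> \bar R) (s : int) : {unit 'F_p} * {unit 'F_p} -> K :=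
  omega_char p v (- s) s.
Arguments chi_of p {R K} v s _.

(** * Numerical data: [modz] and [divz] by a positive integer are the least
    nonnegative residue and the floor of the quotient *)

Definition res (p : nat) (x : int) : int := (x %% (p%:Z - 1))%Z.

Definition k_chi (p : nat) (s : int) : int := 2 + res p (2 * s).
Definition delta_chi (p : nat) (s : int) : int := ((2 * s) %/ (p%:Z - 1))%Z.
Definition t_chi (p : nat) (s : int) : int := s + delta_chi p s + 1.

(* The k of the weight disc of chi, for which [k_bullet] is an exact quotient *)
Definition weights (p : nat) (s : int) : set int :=
  [set k | 2 <= k /\ (k = k_chi p s %[mod p%:Z - 1])%Z].

Definition k_bullet (p : nat) (s k : int) : int :=
  ((k - k_chi p s) %/ (p%:Z - 1))%Z.

Definition d_Iw (p : nat) (s k : int) : int :=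
  k_bullet p s k + 1 - delta_chi p s.

Definition d_ur (p : nat) (s k : int) : int :=
  ((k_bullet p s k - t_chi p s) %/ (p%:Z + 1))%Z + 1.

Definition d_new (p : nat) (s k : int) : int :=
  d_Iw p s k - 2 * d_ur p s k.

(* The minimum is positive in the first branch, where absz is the identity. *)
Definition ghost_mult (p : nat) (s n k : int) : nat :=
  if (d_ur p s k < n) && (n < d_Iw p s k - d_ur p s k)
  then absz (Num.min (n - d_ur p s k) (d_Iw p s k - d_ur p s k - n))
  else 0%N.

(** * The ghost series *)

Definition w_ (p : nat) (R : realType) (K : fieldType) (v : K -> \bar R)
    (k : int) : K := vexp v (p%:R * (k - 2)%:~R) - 1.

(* For fixed n only finitely many factors differ from 1, so that the
   finitely supported product is the full one. *)
Definition ghost_coef (p : nat) (R : realType) (K : fieldType)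
    (v : K -> \bar R) (s n : int) : {poly K} :=
  if n == 0 then 1 else
  \big[*%R/1]_(k \in weights p s) ('X - (w_ p v k)%:P) ^+ ghost_mult p s n k.

(* g_{n, \hat k}: the division is exact *)
Definition ghost_coef_hat (p : nat) (R : realType) (K : fieldType)
    (v : K -> \bar R) (s n k : int) : {poly K} :=
  ghost_coef p v s n %/ (('X - (w_ p v k)%:P) ^+ ghost_mult p s n k).

(* G^(chi)(w, T), as the sequence of its coefficients in T *)
Definition ghost (p : nat) (R : realType) (K : fieldType)
    (v : K -> \bar R) (s : int) (w : K) : nat -> K :=
  fun n => (ghost_coef p v s n%:Z).[w].

(** * Newton polygons *)

(* The height over x of the lower boundary of the convex hull of the points
   (n, v (F n)): the infimum of the ordinates of their convex combinations of
   abscissa x.  Since 0 * +oo = 0, a point at infinity with weight 0 is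
   ignored, and one with positive weight contributes +oo. *)
Definition newton_polygon (R : realType) (K : fieldType) (v : K -> \bar R)
    (F : nat -> K) (x : R) : \bar R :=
  ereal_inf [set y | exists (m : nat) (a : 'I_m -> R) (n : 'I_m -> nat),
    [/\ forall i, 0 <= a i,
        \sum_i a i = 1,
        \sum_i a i * (n i)%:R = x &
        y = (\sum_i (a i)%:E * v (F (n i)))%E]].

Definition newton_slope (R : realType) (K : fieldType) (v : K -> \bar R)
    (F : nat -> K) (l : int) : \bar R :=
  (newton_polygon v F l%:~R - newton_polygon v F (l - 1)%:~R)%E.

(* Main.v *)
Require Import Defs.
From HB Require Import structures.
From mathcomp Require Import all_boot all_order all_algebra.
From mathcomp Require Import all_classical all_reals all_analysis.
From mathcomp Require cyclic.
From mathcomp Require Import zify ring lra.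

Import Order.TTheory GRing.Theory Num.Theory.

Local Open Scope classical_set_scope.
Local Open Scope ring_scope.

(** Write the weights of the disc of [chi] as [k = 2 + 2s + (p-1)x]; then
    [d_k^Iw = x + 1], and [v(g_n(w_k0))] is the sum over [x] of the multiplicity
    [m_n] times [1 + v_p(k0 - k)].  As [m_n] is a tent function of [n], the
    increments of [v(g_n(w_k0))] in [n] are sums of [V(j) = 1 + v_p((p-1)j + a)]
    over intervals of integers [j], hence differences of values of a discrete
    primitive [T] of [V].  Since [V(j) = 1] unless [j = a + pi], and
    [V(a + pi) = 1 + V(i)], we have [T(x) = x + T(ceil((x-a)/p)) + const]; with
    this relation the theta and Atkin-Lehner symmetries hold increment by
    increment.  When [a = 0] the value [V(0)] is infinite; leaving out the factor
    of [k0] shifts the constant when [x] crosses [0], and this shift turns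
    [k0 - 1] into [k0 - 2] on the new interval.

    The symmetries show that the line of slope [k0 - 1] through the point of
    abscissa [d] supports the Newton polygon, which therefore breaks there into
    the two polygons compared.  For the new slopes, the estimate [T(d) <= 2d] in
    the case [a = 0] bounds the increments before [d^ur] by [(k0-2)/2], so that
    the new segment supports the polygon too.  *)

Set Implicit Arguments.
Unset Strict Implicit.
Unset Printing Implicit Defensive.

(* The weight [k] of the disc with [d_k^Iw = x + 1]; it is a weight of the disc
   in the sense of [weights] only if [2 <= k]. *)
Definition wt (p : nat) (s x : int) : int := 2 + 2 * s + (p%:Z - 1) * x.

(* [v(w_k - w_k')] for [x = k - k' != 0].  The value at [0] makes [val_sum] below
   ignore the factor of [g_n] that vanishes at [w_k]. *)
Definition w_val (p : nat) (x : int) : nat :=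
  if x == 0 then 0%N else (logn p `|x|%N).+1.

(** From the cutoff on, [d_ur >= n] and the multiplicity is 0, so that the sum takes in every
    [x >= 0] that matters. *)
Definition val_sum (p : nat) (s k : int) (n : nat) : nat :=
  (\sum_(i < `|s| + n * p.+1) ghost_mult p s n (wt p s i) * w_val p (k - wt p s i)%R)%N.

Lemma divz_unique (m q : int) (d : int) :
  q * d <= m < (q + 1) * d -> (m %/ d)%Z = q.
Proof.
move=> H; have d0 : 0 < d by nia.
have := divz_eq m d; have := modz_ge0 m (lt0r_neq0 d0).
have := ltz_pmod m d0.
nia.
Qed.

Lemma divzP (m d : int) : 0 < d ->
  (m %/ d)%Z * d <= m < ((m %/ d)%Z + 1) * d.
Proof.
move=> d0.
have := divz_eq m d; have := modz_ge0 m (lt0r_neq0 d0).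
have := ltz_pmod m d0.
lia.
Qed.

(** * Multiplicities as functions of [n] and of the weight parameter [x] *)

Section Ghost.
Variables (p : nat) (s : int).
Hypotheses (p_gt2 : (2 < p)%N) (s_ge0 : 0 <= s) (s_le : s <= p%:Z - 2).

Lemma k_chiE : k_chi p s = 2 + 2 * s - (p%:Z - 1) * delta_chi p s.
Proof.
rewrite /k_chi /res /delta_chi.
by have := divz_eq (2 * s) (p%:Z - 1); lia.
Qed.

Lemma k_bullet_wt x : k_bullet p s (wt p s x) = x + delta_chi p s.
Proof.
rewrite /k_bullet k_chiE /wt.
have -> : 2 + 2 * s + (p%:Z - 1) * x -
  (2 + 2 * s - (p%:Z - 1) * delta_chi p s) = (x + delta_chi p s) * (p%:Z - 1).
  by ring.
by rewrite mulzK //; lia.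
Qed.

Lemma d_Iw_wt x : d_Iw p s (wt p s x) = x + 1.
Proof. by rewrite /d_Iw k_bullet_wt; lia. Qed.

Lemma d_ur_wt x : d_ur p s (wt p s x) = ((x - s - 1) %/ (p%:Z + 1))%Z + 1.
Proof. by rewrite /d_ur k_bullet_wt /t_chi; congr ((_ %/ _)%Z + 1); lia. Qed.

(** Trades the floor in [d_ur] for a linear condition on [x]; bounds on [d_ur] come from this
    equivalence at suitable [n]. *)
Lemma d_ur_leE x n : (d_ur p s (wt p s x) <= n) = (x <= s + n * (p%:Z + 1)).
Proof.
rewrite d_ur_wt; have /divzP : 0 < p%:Z + 1 by lia.
move=> /(_ (x - s - 1)); move: (_ %/ _)%Z => u H.
by apply/idP/idP; nia.
Qed.

Lemma d_ur_ge0 x : 0 <= x -> 0 <= d_ur p s (wt p s x).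
Proof. by move=> x0; have := d_ur_leE x (-1); lia. Qed.

Lemma d_new_ge0 x : 0 <= x -> 0 <= d_new p s (wt p s x).
Proof.
move=> x0; rewrite /d_new d_Iw_wt.
have := d_ur_ge0 x0; have := d_ur_leE x (d_ur p s (wt p s x) - 1).
nia.
Qed.

Lemma ghost_mult0 n x : 0 <= x ->
  s + (n%:Z - 1) * (p%:Z + 1) < x -> ghost_mult p s n (wt p s x) = 0%N.
Proof.
move=> x0 H; rewrite /ghost_mult; have := d_ur_leE x (n%:Z - 1).
by case: ifP => //; lia.
Qed.

Lemma ghost_mult0n x : 0 <= x -> ghost_mult p s 0 (wt p s x) = 0%N.
Proof.
by move=> x0; rewrite /ghost_mult; have := d_ur_ge0 x0; case: ifP => //; lia.
Qed.

(** This concerns [x = -1], the only negative value that a weight at least 2 can have; there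
    [d_Iw = 0] and [d_ur >= 0], so no multiplicity is positive. *)
Lemma ghost_mult_lt0 n x : x < 0 -> - 1 <= x -> ghost_mult p s n (wt p s x) = 0%N.
Proof.
move=> x0 x1; rewrite /ghost_mult d_Iw_wt; have := d_ur_leE x (-1).
by case: ifP => //; nia.
Qed.

(** The tent rises after [n] when [d_ur <= n] and [2n + 2 <= d_Iw], falls when [2n >= d_Iw] and
    [n + 1 <= d_Iw - d_ur], and is level otherwise. Solved for [x], these conditions give two
    intervals, with [c] the ceiling of [(n - s)/p]. *)
Lemma ghost_mult_diff (n : nat) (c x : int) : 0 <= x ->
    p%:Z * (c - 1) < n%:Z - s <= p%:Z * c ->
  (ghost_mult p s n.+1 (wt p s x))%:Z - (ghost_mult p s n (wt p s x))%:Z =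
  (2 * n%:Z + 1 <= x < s + n%:Z * (p%:Z + 1) + 1)%R%:Z - (n%:Z + c <= x < 2 * n%:Z)%R%:Z.
Proof.
move=> x0 cP.
have u0 := d_ur_ge0 x0; have uN := d_new_ge0 x0.
have u1 := d_ur_leE x n; have u2 := d_ur_leE x (x - n%:Z).
have {}u2 : (d_ur p s (wt p s x) <= x - n%:Z) = (n%:Z + c <= x).
  by rewrite u2; apply/idP/idP; nia.
have {}u1 : (d_ur p s (wt p s x) <= n) = (x < s + n%:Z * (p%:Z + 1) + 1).
  by rewrite u1; lia.
rewrite -u1 -u2; move: uN; rewrite /ghost_mult /d_new d_Iw_wt.
move: (d_ur _ _ _) u0 => u u0; clear -u0; rewrite !minEle.
by repeat case: ifP; lia.
Qed.
End Ghost.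

(** * Discrete primitives *)

Lemma antidifference (V : int -> int) :
  exists2 T : int -> int, T 0 = 0 & forall x, T (x + 1) = T x + V x.
Proof.
exists (fun x => match x with
  | Posz n => \sum_(i < n) V i | Negz n => - \sum_(i < n.+1) V (Negz i) end).
  by change (\sum_(i < 0) V i = 0); rewrite big_ord0.
case=> [n|[|n]].
- have -> : Posz n + 1 = Posz n.+1 by lia.
  by rewrite big_ord_recr.
- change (\sum_(i < 0) V i = - \sum_(i < 1) V (Negz i) + V (Negz 0)).
  by rewrite big_ord0 big_ord1 addNr.
- have -> : Negz n.+1 + 1 = Negz n by lia.
  by rewrite [in RHS]big_ord_recr /= opprD subrK.
Qed.

Lemma int_const (D : int -> int) :
  (forall x, D (x + 1) = D x) -> forall x, D x = D 0.
Proof.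
move=> H; elim/int_ind=> [//|n <-|n <-].
  by rewrite -(H n%:Z); congr (D _); lia.
by rewrite -[LHS]H; congr (D _); lia.
Qed.

Lemma sum_interval (T V : int -> int) (e A B : int) (N : nat) :
    (forall x, T (x + 1) = T x + V x) -> 0 <= A <= B -> B <= N%:Z ->
  \sum_(i < N) (A <= i%:Z < B)%R%:Z * V (e - i%:Z) = T (e + 1 - A) - T (e + 1 - B).
Proof.
move=> TV AB BN.
(* Truncating both endpoints at [N] gives a formula valid for every [N], so the induction needs no
   bound on [B]. *)
have -> : \sum_(i < N) (A <= i%:Z < B)%R%:Z * V (e - i%:Z) =
    T (e + 1 - Num.min A N%:Z) - T (e + 1 - Num.min B N%:Z).
  elim: N {BN} => [|N IH].
    by rewrite big_ord0 !min_r ?subrr //; lia.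
  rewrite big_ord_recr /= IH.
  have [BN|NB] := lerP B N.
    rewrite !(@min_l _ _ _ N%:Z) ?(@min_l _ _ _ N.+1%:Z); lia.
  rewrite (@min_r _ _ B) ?(@min_r _ _ B N.+1); [|by lia..].
  have -> : e + 1 - N%:Z = (e + 1 - N.+1%:Z) + 1 by lia.
  have [AN|NA] := lerP A N.
    rewrite min_l; last by lia.
    rewrite TV; have -> : e - N%:Z = e + 1 - N.+1%:Z by lia.
    by rewrite mul1r; lia.
  rewrite mul0r min_r; last by lia.
  have -> : e + 1 - N%:Z = e + 1 - N.+1%:Z + 1 by lia.
  by rewrite !subrr.
by rewrite !min_l; lia.
Qed.

(** * Increments of the valuation sums *)

Section ValSum.
Variables (p : nat) (s : int).
Hypotheses (p_gt2 : (2 < p)%N) (s_ge0 : 0 <= s) (s_le : s <= p%:Z - 2).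

Lemma val_sum_widen (k : int) (n N : nat) : (`|s| + n * p.+1 <= N)%N ->
  val_sum p s k n =
  (\sum_(i < N) ghost_mult p s n (wt p s i) * w_val p (k - wt p s i)%R)%N.
Proof.
move=> leN; rewrite /val_sum.
set F := fun i : nat => (ghost_mult p s n (wt p s i) * w_val p (k - wt p s i))%N.
rewrite -(big_mkord xpredT F) -[RHS](big_mkord xpredT F).
rewrite [RHS](big_cat_nat _ leN) //=.
rewrite [X in _ = (_ + X)%N]big_nat_cond [X in _ = (_ + X)%N]big1 ?addn0 // => i.
rewrite andbT => /andP[iN _]; rewrite /F ghost_mult0 //.
nia.
Qed.

Lemma val_sum0 k : val_sum p s k 0 = 0%N.
Proof. by rewrite /val_sum big1 // => i _; rewrite ghost_mult0n. Qed.

(** The first difference of [T] collects the weights whose tent rises after [n], the second those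
    whose tent falls; [k - wt p s x] equals [(p-1)(e - x) + a]. *)
Lemma val_sum_diff (k e a c : int) (n : nat) (T : int -> int) :
    k - 2 - 2 * s = (p%:Z - 1) * e + a ->
    (forall x, T (x + 1) = T x + (w_val p ((p%:Z - 1) * x + a))%:Z) ->
    p%:Z * (c - 1) < n%:Z - s <= p%:Z * c ->
  (val_sum p s k n.+1)%:Z - (val_sum p s k n)%:Z =
  T (e - 2 * n%:Z) - T (e - s - n%:Z * (p%:Z + 1))
  - (T (e + 1 - n%:Z - c) - T (e + 1 - 2 * n%:Z)).
Proof.
move=> ke TV cP.
set N := (`|s| + n.+1 * p.+1)%N.
rewrite (@val_sum_widen k n.+1 N) // (@val_sum_widen k n N); last by rewrite /N; nia.
rewrite !(big_morph Posz PoszD (erefl 0)) -sumrB.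
rewrite (eq_bigr (fun i : 'I_N =>
  (2 * n%:Z + 1 <= i%:Z < s + n%:Z * (p%:Z + 1) + 1)%R%:Z * (w_val p ((p%:Z - 1) * (e - i%:Z) + a))%:Z
  - (n%:Z + c <= i%:Z < 2 * n%:Z)%R%:Z * (w_val p ((p%:Z - 1) * (e - i%:Z) + a))%:Z)); last first.
  move=> i _; rewrite -mulrBl -ghost_mult_diff // !PoszM -mulrBl.
  by congr (_ * (w_val p _)%:Z); rewrite /wt; lia.
rewrite sumrB !(sum_interval e TV); try nia.
by congr (T _ - T _ - (T _ - T _)); lia.
Qed.

End ValSum.

Lemma w_valN p x : w_val p (- x) = w_val p x.
Proof. by rewrite /w_val oppr_eq0 abszN. Qed.

Lemma w_val_pM p x : prime p -> x != 0 -> w_val p (p%:Z * x) = (w_val p x).+1.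
Proof.
move=> pp x0; have p0 := prime_gt0 pp.
rewrite /w_val mulf_eq0 (negbTE x0) orbF; have /negbTE -> : p%:Z != 0 by lia.
rewrite abszM lognM ?absz_gt0 ?absz_nat //; last by lia.
by rewrite (pfactorK 1 pp).
Qed.

Lemma w_val_ndvd p x : ~~ (p %| `|x|)%N -> w_val p x = 1%N.
Proof.
move=> px; rewrite /w_val; case: eqP => [x0|_].
  by rewrite x0 dvdn0 in px.
by rewrite lognE (negbTE px) !andbF.
Qed.

(* [(p-1)x + a] is divisible by [p] exactly when [x = a + pi], and it is then
   [p((p-1)i + a)]. *)
Lemma antidifference_rec (p : nat) (a : int) (T : int -> int) :
    prime p -> (2 < p)%N -> `|a| < p%:Z - 1 ->
    (forall x, T (x + 1) = T x + (w_val p ((p%:Z - 1) * x + a))%:Z) ->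
  exists D : int, forall x y, p%:Z * (y - 1) < x - a <= p%:Z * y ->
    T x = x + T y + D - ((a == 0) && (0 < x))%R%:Z.
Proof.
move=> pp p2 ap TV.
(* The ceiling of [(x - a)/p]. *)
pose ce x := - ((a - x) %/ p%:Z)%Z.
have ceP x y : (p%:Z * (y - 1) < x - a <= p%:Z * y) -> ce x = y.
  by move=> H; rewrite /ce (@divz_unique _ (- y)) ?opprK //; lia.
(* The defect of the relation; it is constant once it is invariant under [x -> x + 1]. *)
pose D x := T x - x - T (ce x) + ((a == 0) && (0 < x))%R%:Z.
have DS x : D (x + 1) = D x.
  have [i xi] : exists i, p%:Z * i <= x - a < p%:Z * (i + 1).
    exists ((x - a) %/ p%:Z)%Z; have /divzP : 0 < p%:Z by lia.
    by move=> /(_ (x - a)); lia.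
  have ceS : ce (x + 1) = i + 1 by apply: ceP; lia.
  (* The ceiling jumps only at [x = a + p i], where the extra valuation pays for the increment of
     [T] at [i]; elsewhere the increment of [T] is 1. *)
  have [xa|xa] := eqVneq x (a + p%:Z * i).
    have ce0 : ce x = i by apply: ceP; lia.
    rewrite /D ceS ce0 !TV.
    have -> : (p%:Z - 1) * x + a = p%:Z * ((p%:Z - 1) * i + a).
      by rewrite xa; ring.
    (* As [|a| < p - 1], this vanishing forces [i = a = x = 0]; there [w_val] is 0 by convention,
       and the jump of the indicator restores the balance. *)
    have [z0|z0] := eqVneq ((p%:Z - 1) * i + a) 0.
      have i0 : i = 0 by nia.
      have a0 : a = 0 by move: z0; rewrite i0; lia.
      have x0 : x = 0 by rewrite xa i0 a0; lia.
      by rewrite z0 mulr0 x0 i0 a0 /=; ring.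
    rewrite w_val_pM //.
    have : (a == 0) && (0 < x + 1) = (a == 0) && (0 < x).
      case: (eqVneq a 0) => [a0|//].
      have i0 : i != 0 by apply: contra_neq z0 => i0; rewrite i0; lia.
      by have : x != 0; [nia|lia].
    by move=> ->; lia.
  have ce0 : ce x = i + 1 by apply: ceP; lia.
  rewrite /D ceS ce0 TV w_val_ndvd.
    have : (a == 0) && (0 < x + 1) = (a == 0) && (0 < x).
      case: eqP => //= a0; have : x != 0; last by lia.
      apply: contra_neq xa => x0; have i0 : i = 0 by nia.
      by rewrite x0 a0 i0 mulr0.
    by move=> ->; lia.
  apply/negP; have -> : (p%:Z - 1) * x + a = p%:Z * (x - i) - (x - a - p%:Z * i) by ring.
  move=> /(@dvdzP p%:Z) [z zE].
  have {zE}: p%:Z * (x - i - z) = x - a - p%:Z * i by lia.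
  have {xi}xi : 0 < x - a - p%:Z * i < p%:Z by lia.
  by have [w|w] := lerP (x - i - z) 0; nia.
exists (D 0) => x y /ceP ce0; have := int_const DS x.
by rewrite /D ce0; lia.
Qed.

Lemma ceil_exists (p x : int) : 0 < p -> exists c, p * (c - 1) < x <= p * c.
Proof.
move=> p0; exists (- ((- x) %/ p)%Z).
by have := divzP (- x) p0; lia.
Qed.

Lemma antidifference_le (T V : int -> int) :
  (forall x, T (x + 1) = T x + V x) -> (forall x, 0 <= V x) ->
  forall x y, x <= y -> T x <= T y.
Proof.
move=> TV V0 x y xy; have -> : y = x + `|y - x|%N%:Z by lia.
elim: `|y - x|%N => [|n IH]; first by rewrite addr0.
have -> : x + n.+1%:Z = x + n%:Z + 1 by lia.
by rewrite TV; have := V0 (x + n%:Z); lia.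
Qed.

(** * Symmetries of the valuations of ghost coefficients *)

Section Identities.
Variables (p : nat) (s s2 : int) (d : nat).
Hypotheses (p_prime : prime p) (p_gt2 : (2 < p)%N).
Hypotheses (s_ge0 : 0 <= s) (s_le : s <= p%:Z - 2).
Hypotheses (s2_ge0 : 0 <= s2) (s2_le : s2 <= p%:Z - 2).
(** Here [d - 1] and [s2] are quotient and remainder of [k0 - 2 - s] by [p - 1]; thus [s2] is the
    exponent of the Atkin-Lehner character and [p - 2 - s2] that of the theta character. *)
Let k0 : int := 2 + (p%:Z - 1) * (d%:Z - 1) + s + s2.

Let ap : `|s2 - s| < p%:Z - 1. Proof. by lia. Qed.

(** Increments in [l] are compared. Both sides use the same [T], as [a = s2 - s] for both, and their
    values of [T] near the top of the tent agree. The recursion turns the value at [x1] into an end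
    value of the other side, and likewise for [x2], leaving [x2 - x1 = k0 - 1]. *)
Lemma val_sum_theta (l : nat) :
  (val_sum p s k0 (d + l))%:Z =
  (val_sum p s k0 d)%:Z + (k0 - 1) * l%:Z
  + (val_sum p (p%:Z - 2 - s2) (2 - k0) l)%:Z.
Proof.
have [T T0 TV] := antidifference (fun j => (w_val p ((p%:Z - 1) * j + (s2 - s)))%:Z).
have [D DP] := antidifference_rec p_prime p_gt2 ap TV.
elim: l => [|l IH]; first by rewrite addn0 val_sum0 ?mulr0 //; lia.
have p0 : 0 < p%:Z by lia.
have [c1 c1P] := ceil_exists ((d + l)%N%:Z - s) p0.
have [c2 c2P] := ceil_exists (l%:Z - (p%:Z - 2 - s2)) p0.
have k1 : k0 - 2 - 2 * s = (p%:Z - 1) * (d%:Z - 1) + (s2 - s).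
  by rewrite /k0; ring.
have k2 : (2 - k0) - 2 - 2 * (p%:Z - 2 - s2) = (p%:Z - 1) * (- d%:Z - 1) + (s2 - s).
  by rewrite /k0; ring.
have s'_ge0 : 0 <= p%:Z - 2 - s2 by lia.
have s'_le : p%:Z - 2 - s2 <= p%:Z - 2 by lia.
have E1 := val_sum_diff p_gt2 s_ge0 s_le k1 TV c1P.
have E2 := val_sum_diff p_gt2 s'_ge0 s'_le k2 TV c2P.
set x1 := d%:Z - 1 - s - (d + l)%N%:Z * (p%:Z + 1) in E1.
set x2 := - d%:Z - 1 - (p%:Z - 2 - s2) - l%:Z * (p%:Z + 1) in E2.
have E3 : T x1 = x1 + T (- d%:Z - l%:Z - c2) + D - ((s2 - s == 0) && (0 < x1))%R%:Z.
  by apply: DP; rewrite /x1; nia.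
have E4 : T x2 = x2 + T (- l%:Z - c1) + D - ((s2 - s == 0) && (0 < x2))%R%:Z.
  by apply: DP; rewrite /x2; nia.
(* Both arguments are nonpositive, so the indicator in the recursion is 0 even if [a = 0]. *)
have x1le : x1 <= 0 by rewrite /x1; nia.
have x2le : x2 <= 0 by rewrite /x2; nia.
have x12 : x2 - x1 = k0 - 1 by rewrite /x1 /x2 /k0; lia.
move: E1 E2; rewrite E3 E4 !(ltNge 0) x1le x2le !andbF addnS.
have -> : d%:Z - 1 - 2 * (d + l)%N%:Z = - d%:Z - 1 - 2 * l%:Z by lia.
have -> : d%:Z - 1 + 1 - 2 * (d + l)%N%:Z = - d%:Z - 1 + 1 - 2 * l%:Z by lia.
have -> : d%:Z - 1 + 1 - (d + l)%N%:Z - c1 = - l%:Z - c1 by lia.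
have -> : - d%:Z - 1 + 1 - l%:Z - c2 = - d%:Z - l%:Z - c2 by lia.
clear -IH x12 => E1 E2; have -> : l.+1%:Z = l%:Z + 1 by lia.
lra.
Qed.

Let dur0 := d_ur p s k0.

Lemma d_ur_leE_central (s12 : s = s2) (i : int) : (dur0 <= i) = (d%:Z - 1 <= s + i * (p%:Z + 1)).
Proof.
have kw : k0 = wt p s (d%:Z - 1) by rewrite /k0 /wt -s12; ring.
by rewrite /dur0 kw d_ur_leE.
Qed.

(* The correction appears when the weight [k0] lies in the weight disc of the
   character, its own factor being left out of [val_sum]. *)
Lemma val_sum_atkin_lehner (n m : nat) : (n + m = d)%N ->
  (val_sum p s k0 n)%:Z + (k0 - 1) * m%:Z =
  (val_sum p s k0 d)%:Z + (val_sum p s2 k0 m)%:Z +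
  (if s == s2 then Num.max 0 (d%:Z - dur0 - Num.max n%:Z dur0) else 0).
Proof.
have [T T0 TV] := antidifference (fun j => (w_val p ((p%:Z - 1) * j + (s2 - s)))%:Z).
have [D DP] := antidifference_rec p_prime p_gt2 ap TV.
(* As [w_val] is even, reflection turns a primitive for [a] into one for [-a], the parameter
   belonging to [s2]. *)
pose T2 x := - T (1 - x).
have T2V x : T2 (x + 1) = T2 x + (w_val p ((p%:Z - 1) * x + (s - s2)))%:Z.
  rewrite /T2; have -> : 1 - x = (1 - (x + 1)) + 1 by lia.
  rewrite TV -w_valN; have -> : - ((p%:Z - 1) * (1 - (x + 1)) + (s2 - s)) =
    (p%:Z - 1) * x + (s - s2) by ring.
  by lia.
have k1 : k0 - 2 - 2 * s = (p%:Z - 1) * (d%:Z - 1) + (s2 - s).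
  by rewrite /k0; ring.
have k2 : k0 - 2 - 2 * s2 = (p%:Z - 1) * (d%:Z - 1) + (s - s2).
  by rewrite /k0; ring.
have p0 : 0 < p%:Z by lia.
(* The induction descends from [n = d], where the correction is 0. *)
elim: m n => [|m IH] n nm.
  rewrite -nm addn0 val_sum0 //; case: eqP => [s12|]; last by lia.
  by have := d_ur_leE_central s12 (-1); lia.
have := IH n.+1; rewrite addSnnS => /(_ nm) {IH}.
have [c1 c1P] := ceil_exists (n%:Z - s) p0.
have [c2 c2P] := ceil_exists (m%:Z - s2) p0.
have E1 := val_sum_diff p_gt2 s_ge0 s_le k1 TV c1P.
have E2 := val_sum_diff p_gt2 s2_ge0 s2_le k2 T2V c2P.
set x1 := d%:Z - 1 - s - n%:Z * (p%:Z + 1) in E1.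
set x2 := d%:Z - 1 - s2 - m%:Z * (p%:Z + 1) in E2.
have E3 : T x1 = x1 + T (- n%:Z + c2) + D - ((s2 - s == 0) && (0 < x1))%R%:Z.
  by apply: DP; rewrite /x1; nia.
have E4 : T (1 - x2) = (1 - x2) + T (d%:Z - n%:Z - c1) + D - ((s2 - s == 0) && (0 < 1 - x2))%R%:Z.
  by apply: DP; rewrite /x2; nia.
have x12 : 1 - x2 - x1 = k0 - 1 by rewrite /x1 /x2 /k0; nia.
move: E1 E2; rewrite /T2 E3.
have -> : 1 - (d%:Z - 1 - 2 * m%:Z) = d%:Z - 1 + 1 - 2 * n%:Z by lia.
have -> : 1 - (d%:Z - 1 + 1 - 2 * m%:Z) = d%:Z - 1 - 2 * n%:Z by lia.
have -> : 1 - (d%:Z - 1 + 1 - m%:Z - c2) = - n%:Z + c2 by lia.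
have -> : d%:Z - 1 + 1 - n%:Z - c1 = d%:Z - n%:Z - c1 by lia.
rewrite E4 => E1 E2 IH; have -> : m.+1%:Z = m%:Z + 1 by lia.
(* For [s = s2] the correction is constant up to [n = dur0], drops by 1 at each step until
   [d - dur0], and is 0 afterwards; the two indicators mark these bends. *)
have : (if s == s2 then Num.max 0 (d%:Z - dur0 - Num.max n%:Z dur0) else 0) =
  (if s == s2 then Num.max 0 (d%:Z - dur0 - Num.max n.+1%:Z dur0) else 0)
  + ((s2 - s == 0) && (0 < 1 - x2))%R%:Z - ((s2 - s == 0) && (0 < x1))%R%:Z.
  rewrite subr_eq0 [s2 == s]eq_sym; case: eqP => //= s12.
  have u1 := d_ur_leE_central s12 n; have u2 := d_ur_leE_central s12 m.
  have {}u1 : (0 < x1) = (n%:Z < dur0) by rewrite /x1; lia.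
  have {}u2 : (0 < 1 - x2) = (dur0 <= m%:Z) by rewrite /x2 u2; lia.
  have u0 : 0 <= dur0 by have := d_ur_leE_central s12 (-1); lia.
  have u3 : 2 * dur0 <= d%:Z by have := d_ur_leE_central s12 (dur0 - 1); nia.
  rewrite u1 u2; move: dur0 u0 u3 => u u0 u3; clear -nm u0 u3; lia.
by lra.
Qed.

Lemma val_sum_diff_le (n : nat) : (11 <= p)%N -> s = s2 -> n%:Z < dur0 ->
  2 * ((val_sum p s k0 n.+1)%:Z - (val_sum p s k0 n)%:Z) <= k0 - 2.
Proof.
move=> p11 s12 ndu.
have [T T0 TV] := antidifference (fun j => (w_val p ((p%:Z - 1) * j + (s2 - s)))%:Z).
have [D DP] := antidifference_rec p_prime p_gt2 ap TV.
have Tle := antidifference_le TV (fun x => isT).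
have p0 : 0 < p%:Z by lia.
have a0 : s2 - s = 0 by lia.
have D0 : D = 0.
  have : T 0 = 0 + T 0 + D - ((s2 - s == 0) && (0 < 0 :> int))%R%:Z.
    by apply: DP; lia.
  by rewrite T0 andbF; lia.
(* Strong induction: for [x >= 2], [T x = x + T c - 1] with [c] the ceiling of [x/p], and
   [2c <= x + 1]. *)
have T_le (x : nat) : T x <= 2 * x%:Z.
  have [m] := ubnP x; elim: m x => // m IH [|[|x]] xm; first by rewrite T0.
    by have := TV 0; rewrite T0 a0 mulr0 addr0 add0r => ->.
  have [c cP] := ceil_exists x.+2%:Z p0.
  have c1 : 0 < c < x.+2%:Z by nia.
  have c2 : 2 * c <= x.+2%:Z + 1 by nia.
  rewrite (DP x.+2%:Z c); last by lia.
  by have := IH `|c|%N; rewrite gez0_abs; lia.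
have k1 : k0 - 2 - 2 * s = (p%:Z - 1) * (d%:Z - 1) + (s2 - s).
  by rewrite /k0; ring.
have [c cP] := ceil_exists (n%:Z - s) p0.
rewrite (val_sum_diff p_gt2 s_ge0 s_le k1 TV cP).
have x1 : 0 <= d%:Z - 1 - s - n%:Z * (p%:Z + 1).
  by have := d_ur_leE_central s12 n; lia.
have := Tle _ _ x1; rewrite T0.
have : T (d%:Z - 1 + 1 - 2 * n%:Z) <= T (d%:Z - 1 + 1 - n%:Z - c).
  by apply: Tle; nia.
have : T (d%:Z - 1 - 2 * n%:Z) <= T d by apply: Tle; lia.
(* The subtracted outer value of [T] is nonnegative and the falling interval only lowers the
   increment, which is therefore at most [T d <= 2d]. The rest follows from [p - 1 >= 10] and
   [d >= 2]. *)
have := T_le d; suff : 4 * d%:Z <= k0 - 2 by lra.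
rewrite /k0.
have sd : s < d%:Z - 1 by have := d_ur_leE_central s12 0; lia.
clear -p11 sd s_ge0 s2_ge0 s12; have q : 10 <= p%:Z - 1 by lia.
by nia.
Qed.

End Identities.

(** * Valuation sums when [k0] lies in the progression of the character ([s = s2]) *)

Section Central.
Variables (p : nat) (s : int) (d : nat).
Hypotheses (p_prime : prime p) (p_ge11 : (11 <= p)%N).
Hypotheses (s_ge0 : 0 <= s) (s_le : s <= p%:Z - 2).
Let k0 : int := 2 + (p%:Z - 1) * (d%:Z - 1) + s + s.
Variable (u : nat).
Hypothesis uE : d_ur p s k0 = u%:Z.
Let val n : int := (val_sum p s k0 n)%:Z.

Let p_gt2 : (2 < p)%N. Proof. by lia. Qed.

Lemma d_ur_double_le : (2 * u <= d)%N.
Proof.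
have := @d_ur_leE_central p s s d p_gt2 s_ge0 s_le erefl (u%:Z - 1).
rewrite uE; have [->|u0] := posnP u; first by [].
have : 2 * (u%:Z - 1) <= (u%:Z - 1) * (p%:Z + 1) by nia.
by lia.
Qed.

Lemma val_sum_atkin_lehner_central (n m : nat) : (n + m = d)%N ->
  val n + (k0 - 1) * m%:Z = val d + val m + Num.max 0 (d%:Z - u%:Z - Num.max n%:Z u%:Z).
Proof.
move=> nm; have := @val_sum_atkin_lehner p s s d p_prime p_gt2 s_ge0 s_le s_ge0 s_le n m nm.
by rewrite eqxx -/k0 uE.
Qed.

Lemma val_sum_le_ur (n : nat) : (n <= u)%N ->
  2 * (val u - val n) <= (k0 - 2) * (u%:Z - n%:Z).
Proof.
move=> nu; have -> : n = (u - (u - n))%N by lia.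
have : (u - n <= u)%N by lia.
elim: (u - n)%N => [|m IH] mu; first by rewrite subn0 !subrr !mulr0.
have {}IH := IH (ltnW mu).
have := @val_sum_diff_le p s s d p_prime p_gt2 s_ge0 s_le s_ge0 s_le (u - m.+1)%N p_ge11 erefl.
have -> : (u - m.+1).+1 = (u - m)%N by lia.
rewrite -/k0 uE => /(_ _) h.
have {}h := h ltac:(lia).
have e1 : u%:Z - (u - m)%N%:Z = m%:Z by lia.
have -> : u%:Z - (u - m.+1)%N%:Z = m%:Z + 1 by lia.
rewrite e1 in IH; rewrite /val in IH *.
by lra.
Qed.

(** The corrections in the Atkin-Lehner relations at [m] and [d - m] differ by [d - 2m]; subtracting
    the relations therefore lowers [k0 - 1] to [k0 - 2]. *)
Lemma val_sum_dual (m : nat) : (u <= m <= d - u)%N ->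
  2 * (val (d - m) - val m) = (k0 - 2) * (d%:Z - 2 * m%:Z).
Proof.
move=> /andP[um md]; have ud := d_ur_double_le.
have h1 := @val_sum_atkin_lehner_central m (d - m) ltac:(lia).
have h2 := @val_sum_atkin_lehner_central (d - m) m ltac:(lia).
have e3 : Num.max 0 (d%:Z - u%:Z - Num.max m%:Z u%:Z) = d%:Z - u%:Z - m%:Z by lia.
have e4 : Num.max 0 (d%:Z - u%:Z - Num.max (d - m)%N%:Z u%:Z) = m%:Z - u%:Z by lia.
rewrite e3 in h1; rewrite e4 in h2.
have e1 : (d - m)%N%:Z = d%:Z - m%:Z by lia.
rewrite e1 in h1.
by lra.
Qed.

(** The correction has the same value [d - 2u] for all [n <= u] and cancels. *)
Lemma val_sum_atkin_lehner_ur (n : nat) : (n <= u)%N ->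
  val (d - n) - val (d - u) = val n - val u + (k0 - 1) * (u%:Z - n%:Z).
Proof.
move=> nu; have ud := d_ur_double_le.
have h1 := @val_sum_atkin_lehner_central n (d - n) ltac:(lia).
have h2 := @val_sum_atkin_lehner_central u (d - u) ltac:(lia).
have e0 : Num.max n%:Z u%:Z = u%:Z by lia.
have e1 : (d - n)%N%:Z = d%:Z - n%:Z by lia.
have e2 : (d - u)%N%:Z = d%:Z - u%:Z by lia.
rewrite e0 e1 in h1; rewrite maxxx e2 in h2.
by lra.
Qed.

(** Up to [l = u], Atkin-Lehner reflects the bound [(k0-2)/2] into [(k0-1) - (k0-2)/2 = k0/2];
    beyond, theta gives increments of at least [k0 - 1 >= k0/2]. *)
Lemma val_sum_ge_Iw (l : nat) : 2 <= k0 ->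
  k0 * l%:Z <= 2 * (val (d - u + l) - val (d - u)).
Proof.
move=> k2; have ud := d_ur_double_le; have [lu|ul] := leqP l u.
  have h1 := @val_sum_atkin_lehner_ur (u - l) (leq_subr _ _).
  have h2 := @val_sum_le_ur (u - l) (leq_subr _ _).
  have e1 : u%:Z - (u - l)%N%:Z = l%:Z by lia.
  have e2 : (d - (u - l) = d - u + l)%N by lia.
  by rewrite e1 ?e2 in h1 h2; lra.
have h1 := @val_sum_atkin_lehner_ur 0 (leq0n _).
have h2 := @val_sum_le_ur 0 (leq0n _).
rewrite subn0 in h1.
have h3 := @val_sum_theta p s s d p_prime p_gt2 s_ge0 s_le s_ge0 s_le (l - u).
have e2 : (d + (l - u) = d - u + l)%N by lia.
have e1 : (l - u)%N%:Z = l%:Z - u%:Z by lia.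
rewrite -/k0 e1 e2 in h3.
set x := (val_sum _ _ (2 - _) _)%:Z in h3.
have x0 : 0 <= x by [].
have lu : 0 <= (k0 - 2) * (l%:Z - u%:Z) by apply: mulr_ge0; lia.
by rewrite /val in h1 h2 *; lra.
Qed.

End Central.

(** * Valuations in C_p *)

Lemma logn_fact_le (p n : nat) : prime p -> (p.-1 * logn p n`! <= n)%N.
Proof.
move=> pp; have p1 := prime_gt1 pp; rewrite logn_fact //.
(* In Legendre's formula, keeping the quotient by [p ^ m] on the left makes the sum telescope. *)
suff H m : (p.-1 * \sum_(1 <= k < m.+1) n %/ p ^ k + n %/ p ^ m <= n)%N.
  exact: leq_trans (leq_addr _ _) (H n).
elim: m => [|m IH]; first by rewrite big_nil muln0 expn0 divn1.
rewrite big_nat_recr //= mulnDr -addnA -mulSnr prednK; last by lia.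
apply: leq_trans IH; rewrite leq_add2l expnSr divnMA mulnC.
exact: leq_trunc_div.
Qed.

Section Valuation.
Variables (p : nat) (R : realType) (K : closedFieldType) (v : K -> \bar R).
Hypothesis p_prime : prime p.
Hypothesis CpK : is_Cp p v.

Let v0 := Cp_v0 CpK.
Let vfin := Cp_vfin CpK.
Let vM := Cp_vM CpK.

Lemma v_1 : v 1 = 0%E.
Proof.
have := vM 1 1; rewrite mulr1; have := vfin (oner_neq0 K).
by case: (v 1) => // r _ [] h; congr (_%:E); lra.
Qed.

Lemma v_N x : v (- x) = v x.
Proof.
have N1 : v (-1) = 0%E.
  have := vM (-1) (-1); rewrite mulrNN mulr1 v_1.
  have : (-1 : K) != 0 by rewrite oppr_eq0 oner_neq0.
  by move=> /vfin; case: (v _) => // r _ [] h; congr (_%:E); lra.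
by rewrite -mulN1r vM N1 add0e.
Qed.

Lemma v_ge_add (M : \bar R) x y : (M <= v x -> M <= v y -> M <= v (x + y)%R)%E.
Proof.
by move=> Mx My; apply: le_trans (Cp_vD CpK x y); rewrite le_min Mx.
Qed.

Lemma v_ge_sub (M : \bar R) x y : (M <= v x -> M <= v y -> M <= v (x - y)%R)%E.
Proof. by move=> Mx My; apply: v_ge_add; rewrite ?v_N. Qed.

Lemma v_ge_sum (M : \bar R) I (r : seq I) (P : pred I) (F : I -> K) :
  (forall i, P i -> M <= v (F i))%E -> (M <= v (\sum_(i <- r | P i) F i))%E.
Proof.
move=> MF; elim/big_ind: _ => //; first by rewrite v0 leey.
exact: v_ge_add.
Qed.

Lemma v_add_lt x y : (v x < v y)%E -> v (x + y) = v x.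
Proof.
move=> xy; apply/eqP; rewrite eq_le; apply/andP; split; last first.
  by apply: v_ge_add => //; exact: ltW.
rewrite leNgt; apply/negP => xxy.
have : (Order.min (v (x + y)) (v y) <= v x)%E.
  by rewrite -{2}[x](addrK y); apply: v_ge_sub; rewrite ge_min lexx ?orbT.
by rewrite ge_min !leNgt xxy xy.
Qed.

Lemma v_prod I (r : seq I) (P : pred I) (F : I -> K) :
  v (\prod_(i <- r | P i) F i) = (\sum_(i <- r | P i) v (F i))%E.
Proof. by apply: (big_morph v vM v_1). Qed.

Lemma v_X x r n : v x = r%:E -> v (x ^+ n) = (r *+ n)%:E.
Proof.
move=> xr; elim: n => [|n IH]; first by rewrite expr0 v_1.
by rewrite exprS vM IH xr -EFinD mulrS.
Qed.

Lemma v_nat_ge0 n : (0 <= v n%:R)%E.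
Proof.
elim: n => [|n IH]; first by rewrite v0 leey.
by rewrite -addn1 natrD; apply: v_ge_add; rewrite ?v_1.
Qed.

Lemma v_nat n : (0 < n)%N -> v n%:R = (logn p n)%:R%:E.
Proof.
move=> n0; have [m pm {1}->] := pfactor_coprime p_prime n0.
rewrite natrM vM natrX (v_X _ (Cp_vp CpK)).
(* If the part prime to [p] had positive valuation, a Bezout relation would give 1 positive
   valuation. *)
suff -> : v m%:R = 0%E by rewrite add0e.
apply/eqP; rewrite eq_le v_nat_ge0 andbT leNgt; apply/negP => vm.
have m0 : (0 < m)%N.
  case: m vm pm => // vm; rewrite /coprime gcdn0 => /eqP p1.
  by move: p_prime; rewrite p1.
have [a b ab _] := egcdnP p m0.
have := lt_irreflexive (v 1); rewrite {1}v_1.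
have -> : (1 : K) = a%:R * m%:R - b%:R * p%:R.
  rewrite -!natrM ab natrD addrAC subrr add0r gcdnC.
  by move/eqP: pm => ->.
suff : (Order.min (v m%:R) 1 <= v (a%:R * m%:R - b%:R * p%:R))%E.
  by move=> h; rewrite (lt_le_trans _ h) // lt_min vm lte01.
apply: v_ge_sub; rewrite vM.
  by apply: (@le_trans _ _ (v m%:R)); rewrite ?leeDr ?v_nat_ge0 // ge_min lexx.
rewrite (Cp_vp CpK); apply: (@le_trans _ _ 1%E); first by rewrite ge_min lexx orbT.
by rewrite leeDr // v_nat_ge0.
Qed.

Lemma v_int_ge0 (x : int) : (0 <= v x%:~R)%E.
Proof.
by case: x => n; rewrite ?NegzE ?mulrNz ?v_N; exact: v_nat_ge0.
Qed.

Lemma v_int (x : int) : x != 0 -> v x%:~R = (logn p `|x|)%:R%:E.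
Proof.
move=> x0; rewrite -v_nat ?absz_gt0 //.
by case: x {x0} => n //; rewrite NegzE mulrNz v_N abszN.
Qed.

Lemma v_V x : x != 0 -> v x^-1 = (- v x)%E.
Proof.
move=> x0; have := vM x x^-1; rewrite divff // v_1.
have := vfin x0; have := vfin (invr_neq0 x0).
by case: (v x) => // r; case: (v x^-1) => // t _ _ [] h; congr (_%:E); lra.
Qed.

Lemma nat_neq0 n : (0 < n)%N -> n%:R != 0 :> K.
Proof.
move=> n0; apply/eqP => e0; have := v_nat n0.
by rewrite e0 v0.
Qed.

Let exp_term (m : int) (n : nat) : K := (p%:R * m%:~R) ^+ n / n`!%:R.

Lemma v_exp_term m n :
  ((n%:R - (logn p n`!)%:R)%:E <= v (exp_term m n))%E.
Proof.
rewrite /exp_term exprMn vM vM (v_X _ (Cp_vp CpK)) v_V ?nat_neq0 ?fact_gt0 //.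
rewrite v_nat ?fact_gt0 // addeAC -EFinB leeDl // -rmorphXn.
exact: v_int_ge0.
Qed.

Hypothesis p_ge11 : (11 <= p)%N.

Lemma vcvg_vexp (m : int) :
  vcvg v (series (exp_term m)) (vexp v (p%:R * m%:~R)).
Proof.
apply: (@xgetPex _ 0); apply: Cp_complete CpK _ _ => M.
have [N NM] : exists N, forall n, (N <= n)%N -> (M%:E <= v (exp_term m n))%E.
  (* As [v(n!) <= n/2], the [n]-th term has valuation at least [n/2]. *)
  exists (2 * `|Num.ceil M|)%N => n nN; apply: le_trans (v_exp_term m n).
  rewrite lee_fin.
  have nl : (2 * logn p n`! <= n)%N.
    by apply: leq_trans (logn_fact_le n p_prime); rewrite leq_mul2r; lia.
  have := ceil_ge M.
  have : (Num.ceil M)%:~R <= (`|Num.ceil M|%N)%:R :> R.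
    by rewrite pmulrn ler_int; lia.
  have : (`|Num.ceil M|%N + logn p n`!)%:R <= n%:R :> R by rewrite ler_nat; lia.
  by rewrite natrD; lra.
exists N => a b; wlog ab : a b / (a <= b)%N => [W|Na Nb].
  by have /orP[/W//|/W{}W Na Nb] := leq_total a b; rewrite -v_N opprB W.
rewrite -v_N opprB sub_series_geq //; rewrite big_nat_cond.
by apply: v_ge_sum => i /andP[/andP[ai _] _]; apply/NM/(leq_trans Na).
Qed.

(** The linear terms differ by [p(m - n)], of valuation exactly [w_val p (m - n)]; all the rest of
    the difference has larger valuation. *)
Lemma v_exp_diff (m n : int) : m != n ->
  v (vexp v (p%:R * m%:~R) - vexp v (p%:R * n%:~R)) = (w_val p (m - n))%:R%:E.
Proof.
move=> mn; have mn0 : m - n != 0 by rewrite subr_eq0.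
set w := w_val p (m - n).
have [l wE vl] : exists2 l, w = l.+1 & v (m - n)%:~R = l%:R%:E.
  by exists (logn p `|m - n|); rewrite ?v_int // /w /w_val (negbTE mn0).
have w1 : v (p%:R * m%:~R - p%:R * n%:~R) = w%:R%:E.
  by rewrite -mulrBr -rmorphB vM vl (Cp_vp CpK) -EFinD wE -nat1r.
have big i : (1 < i)%N -> ((w.+1)%:R%:E <= v (exp_term m i - exp_term n i))%E.
  move=> i1.
  (* [m - n] divides [m ^ i - n ^ i], and the factor [p ^ i / i!] has valuation at least 2 for
     [i >= 2]. *)
  pose z : int := \sum_(j < i) m ^+ (i.-1 - j) * n ^+ j.
  have mnz : m%:~R ^+ i - n%:~R ^+ i = (m - n)%:~R * z%:~R :> K.
    by rewrite -!rmorphXn -rmorphB subrXX rmorphM.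
  have -> : exp_term m i - exp_term n i =
      (m - n)%:~R * p%:R ^+ i / i`!%:R * z%:~R.
    by rewrite /exp_term -mulrBl !exprMn -mulrBr mnz; ring.
  rewrite vM vM vM vl (v_X _ (Cp_vp CpK)) v_V ?nat_neq0 ?fact_gt0 //.
  rewrite v_nat ?fact_gt0 // -EFinD.
  apply: (@le_trans _ _ _ _ _ _ (leeDl _ (v_int_ge0 z))).
  rewrite lee_fin lerBrDr -!natrD ler_nat wE.
  have : (10 * logn p i`! <= i)%N.
    by apply: leq_trans (logn_fact_le i p_prime); rewrite leq_mul2r; lia.
  by lia.
have [N0 _ lim1] := (cvgeyPge _).1 (vcvg_vexp m) w.+1%:R.
have [N1 _ lim2] := (cvgeyPge _).1 (vcvg_vexp n) w.+1%:R.
(* The partial sums approximate both limits up to valuation [w + 1]; the [.+2] makes them contain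
   the constant and linear terms. *)
pose N := (N0 + N1).+2.
have {}lim1 := lim1 N; have {}lim2 := lim2 N.
have sumE : series (exp_term m) N - series (exp_term n) N =
   (p%:R * m%:~R - p%:R * n%:~R) + \sum_(2 <= i < N) (exp_term m i - exp_term n i).
  have serE j : series (exp_term j) N = \sum_(0 <= i < N) exp_term j i by [].
  rewrite !serE -sumrB big_ltn // big_ltn // /exp_term !expr0 subrr add0r.
  by rewrite !expr1 (_ : 1`!%N = 1%N) // !divr1.
set e1 := vexp _ _ in lim1 *; set e2 := vexp _ _ in lim2 *.
have -> : e1 - e2 = (p%:R * m%:~R - p%:R * n%:~R) +
  (\sum_(2 <= i < N) (exp_term m i - exp_term n i)
   - ((series (exp_term m) N - e1) - (series (exp_term n) N - e2))).
  by rewrite addrA -sumE; ring.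
rewrite v_add_lt w1 //; apply: (@lt_le_trans _ _ w.+1%:R%:E).
  by rewrite lte_fin ltr_nat.
apply: v_ge_sub.
  by rewrite big_nat_cond; apply: v_ge_sum => i /andP[/andP[i2 _] _]; exact: big.
by apply: v_ge_sub; [apply: lim1 | apply: lim2]; rewrite /N /=; lia.
Qed.

Lemma v_w_diff (k k' : int) : k != k' ->
  v (w_ p v k - w_ p v k') = (w_val p (k - k'))%:R%:E.
Proof.
move=> kk; rewrite /w_ opprB addrA subrK v_exp_diff; last first.
  by apply: contra_neq kk => /addIr.
by do 3 f_equal; ring.
Qed.

End Valuation.

(** * Teichmuller characters and values of the ghost coefficients *)

Section Ghost.
Variables (p : nat) (R : realType) (K : closedFieldType) (v : K -> \bar R).
Hypotheses (p_prime : prime p) (p_ge11 : (11 <= p)%N) (CpK : is_Cp p v).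

(** It suffices that a Teichmuller lift exists. By Euler's theorem [A ^ p.-1 - 1], the product of
    [A - z] over the roots [z] of [X ^ p.-1 - 1], has positive valuation; hence so has some
    factor. *)
Lemma teichmuller_spec (a : {unit 'F_p}) :
  teichmuller v a ^+ p.-1 = 1 /\ teichmuller v a != 0.
Proof.
have p1 : (0 < p.-1)%N by lia.
suff h : teichmuller v a ^+ p.-1 = 1.
  by split=> //; apply: contra_eq_neq h => ->; rewrite expr0n gtn_eqF // eq_sym oner_neq0.
apply: (@proj1 _ _ (@xgetPex _ 0 [set z | z ^+ p.-1 = 1 /\ _] _)).
set A : nat := val a.
have Ap : coprime A p.
  rewrite coprime_sym prime_coprime //; apply/negP => pA.
  have : (val a : 'F_p) == 0.
    rewrite -val_eqE /= -[X in X == _](@modn_small _ p) //.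
    by have := ltn_ord (val a); rewrite [X in (_ < X)%N]Fp_cast.
  by apply/negP; rewrite -unitfE; exact: valP a.
have A0 : (0 < A)%N.
  by rewrite lt0n; apply: contraTneq Ap => ->; rewrite /coprime gcd0n; lia.
have vA : (0 < v (A%:R ^+ p.-1 - 1))%E.
  have := cyclic.Euler_exp_totient Ap; rewrite totient_prime // => /eqP.
  rewrite eqn_mod_dvd ?expn_gt0 ?A0 //.
  move=> /dvdnP[q qE]; rewrite -natrX -[X in _ - X]/(1%:R) -natrB ?expn_gt0 ?A0 //.
  rewrite qE natrM (Cp_vM CpK) (Cp_vp CpK).
  by apply: (@lt_le_trans _ _ 1%E); rewrite // leeDr // (v_nat_ge0 CpK).
have [r rE] := closed_field_poly_normal ('X^(p.-1) - 1%:P : {poly K}).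
have lP : lead_coef ('X^(p.-1) - 1%:P : {poly K}) = 1.
  by apply/monicP; apply: monicXnsubC.
rewrite lP scale1r in rE.
have rP z : z \in r -> z ^+ p.-1 = 1.
  move=> zr; apply/eqP; rewrite -subr_eq0.
  have : root ('X^(p.-1) - 1%:P) z by rewrite rE root_prod_XsubC.
  by rewrite /root !hornerE.
move: vA; have -> : A%:R ^+ p.-1 - 1 = \prod_(z <- r) (A%:R - z) :> K.
  have := congr1 (horner^~ A%:R) rE; rewrite !hornerE horner_prod => ->.
  by apply: eq_bigr => z _; rewrite !hornerE.
rewrite (v_prod CpK) => vA; apply: contrapT => nz.
move: vA; apply/negP; rewrite -leNgt big_seq; apply: sume_le0 => z zr.
rewrite leNgt; apply/negP => vz; apply: nz; exists z; split; first exact: rP.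
by rewrite -(v_N CpK) opprB.
Qed.

Lemma teichmuller_expz (a : {unit 'F_p}) (i j : int) :
  (i = j %[mod p%:Z - 1])%Z -> teichmuller v a ^ i = teichmuller v a ^ j.
Proof.
have [h1 h0] := teichmuller_spec a; set z := teichmuller v a in h0 h1 *.
have red x : z ^ x = z ^ (x %% (p%:Z - 1))%Z.
  rewrite {1}(divz_eq x (p%:Z - 1)) expfzDr // [(_ %/ _)%Z * _]mulrC -exprz_exp.
  have -> : z ^ (p%:Z - 1) = 1.
    by have -> : p%:Z - 1 = p.-1%:Z by lia.
  by rewrite exp1rz mul1r.
by move=> ij; rewrite red ij -red.
Qed.

Lemma chi_of_twist (s k : int) :
  chi_of p v s \* omega_char p v (k - 1) (1 - k) = chi_of p v (res p (s + 1 - k)).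
Proof.
apply/funext => a; rewrite /= /chi_of /omega_char /res.
have h0 b := (teichmuller_spec b).2.
rewrite mulrACA -!expfzDr //; congr (_ * _); apply: teichmuller_expz.
  have := divz_eq (s + 1 - k) (p%:Z - 1).
  set q := (_ %/ _)%Z; set r := (_ %% _)%Z => E.
  have -> : - s + (k - 1) = (- q) * (p%:Z - 1) + (- r) by lia.
  by rewrite modzMDl.
by rewrite modz_mod; congr (_ %% _)%Z; ring.
Qed.

Section Coef.
Variable (s : int).
Hypotheses (s_ge0 : 0 <= s) (s_le : s <= p%:Z - 2).

Let p_gt2 : (2 < p)%N. Proof. by lia. Qed.

Lemma wt_inj : injective (wt p s).
Proof.
move=> x y; rewrite /wt => /addrI /(mulfI _); apply.
by rewrite subr_eq0; lia.
Qed.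

Lemma weightsP k : weights p s k <-> exists2 x, k = wt p s x & 2 <= k.
Proof.
have md x : (wt p s x = k_chi p s %[mod p%:Z - 1])%Z.
  rewrite k_chiE // /wt; have -> : 2 + 2 * s + (p%:Z - 1) * x =
    (x + delta_chi p s) * (p%:Z - 1) + (2 + 2 * s - (p%:Z - 1) * delta_chi p s).
    by ring.
  by rewrite modzMDl.
split=> [[k2 kk]|[x -> k2]]; last by split.
exists ((k %/ (p%:Z - 1))%Z - (wt p s 0 %/ (p%:Z - 1))%Z) => //.
have := divz_eq k (p%:Z - 1); have := divz_eq (wt p s 0) (p%:Z - 1).
rewrite kk (md 0).
have wtE y : wt p s y = wt p s 0 + (p%:Z - 1) * y by rewrite /wt; ring.
rewrite [in X in _ -> _ -> X]wtE; lia.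
Qed.

Lemma wt_ge2 x : 2 <= wt p s x -> - 1 <= x.
Proof. by rewrite /wt; nia. Qed.

(** Weights with [x = -1] or [x] beyond the cutoff have multiplicity 0. [N] is left free so that a
    chosen factor can be made to appear. *)
Lemma ghost_coefE (n N : nat) : (`|s| + n * p.+1 <= N)%N ->
  ghost_coef p v s n%:Z =
  \prod_(i < N) ('X - (w_ p v (wt p s i))%:P) ^+ ghost_mult p s n (wt p s i).
Proof.
move=> nN; rewrite /ghost_coef; case: ifP => [/eqP n0|_].
  by rewrite n0 big1 // => i _; rewrite ghost_mult0n.
pose F k := ('X - (w_ p v k)%:P) ^+ ghost_mult p s n k.
rewrite (@fsbig_ord _ _ _ N (fun i : nat => F (wt p s i))).
pose I : set nat := [set i | (i < N)%N].
rewrite -(reindex_fsbig (fun i : nat => wt p s i) I [set wt p s i%:Z | i in I] F).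
  apply/esym/fsbig_widen => [_ [i _ <-]|k [/weightsP[x -> k2] nx]].
    by apply/weightsP; exists i => //; rewrite /wt; nia.
  rewrite /F /=; have x1 := wt_ge2 k2.
  suff -> : ghost_mult p s n (wt p s x) = 0%N by [].
  have [x0|x0] := lerP 0 x; last exact: ghost_mult_lt0.
  apply: ghost_mult0 => //; rewrite ltNge; apply/negP => xn; apply: nx.
  by exists `|x|%N => /=; [rewrite /I /=; nia | rewrite gez0_abs].
by split=> //= i j _ _ /wt_inj [].
Qed.

Lemma v_ghost_prod (n N : nat) (P : pred 'I_N) k :
    (forall i, P i -> k = wt p s i -> ghost_mult p s n (wt p s i) = 0%N) ->
  v (\prod_(i < N | P i) ('X - (w_ p v (wt p s i))%:P) ^+ ghost_mult p s n (wt p s i)).[w_ p v k]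
  = (\sum_(i < N | P i) ghost_mult p s n (wt p s i) * w_val p (k - wt p s i)%R)%N%:R%:E.
Proof.
move=> Pk; rewrite horner_prod (v_prod CpK) natr_sum -sumEFin.
apply: eq_bigr => i Pi; rewrite horner_exp !hornerE.
have [kE|kE] := eqVneq k (wt p s i).
  by rewrite Pk // expr0 (v_1 CpK).
by rewrite (v_X CpK _ (v_w_diff p_prime CpK p_ge11 kE)) mulnC natrM mulr_natr.
Qed.

Lemma v_ghost_fin k (n : nat) :
    (forall x, 0 <= x -> k = wt p s x -> ghost_mult p s n k = 0%N) ->
  v (ghost p v s (w_ p v k) n) = (val_sum p s k n)%:R%:E.
Proof.
move=> h; rewrite /ghost (ghost_coefE (leqnn _)) v_ghost_prod // => i _ ki.
by rewrite -ki (h i).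
Qed.

Lemma v_ghost_inf x (n : nat) : 0 <= x -> (0 < ghost_mult p s n (wt p s x))%N ->
  v (ghost p v s (w_ p v (wt p s x)) n) = +oo%E.
Proof.
move=> x0 m0; pose N := (`|s| + n * p.+1 + `|x|.+1)%N.
have xN : (`|x| < N)%N by rewrite /N; lia.
rewrite /ghost (@ghost_coefE n N) ?leq_addr // (bigD1 (Ordinal xN)) //=.
rewrite gez0_abs // hornerM horner_exp !hornerE subrr expr0n.
by rewrite gtn_eqF // mul0r (Cp_v0 CpK).
Qed.

Lemma v_ghost_hat x (n : nat) : - 1 <= x ->
  v (ghost_coef_hat p v s n%:Z (wt p s x)).[w_ p v (wt p s x)] =
  (val_sum p s (wt p s x) n)%:R%:E.
Proof.
move=> x1; rewrite /ghost_coef_hat; have [x0|x0] := lerP 0 x; last first.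
  rewrite ghost_mult_lt0 // expr0 divp1 (v_ghost_fin (k := wt p s x) (n := n)) //.
  by move=> y y0 /wt_inj xy; lia.
(* The range is enlarged to contain [x], so that the factor to be divided out appears; its term in
   [val_sum] is 0 as [w_val p 0 = 0]. *)
pose N := (`|s| + n * p.+1 + `|x|.+1)%N.
have xN : (`|x| < N)%N by rewrite /N; lia.
rewrite (@ghost_coefE n N) ?leq_addr // (bigD1 (Ordinal xN)) //= gez0_abs //.
rewrite mulrC Pdiv.IdomainMonic.mulpK ?monic_exp ?monicXsubC //.
rewrite v_ghost_prod; last first.
  move=> i ix /wt_inj ex; case/eqP: ix; apply: val_inj => /=; lia.
have nN : (`|s| + n * p.+1 <= N)%N by rewrite leq_addr.
rewrite (val_sum_widen p_gt2 s_ge0 s_le _ nN) [in RHS](bigD1 (Ordinal xN)) //=.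
by rewrite gez0_abs // subrr (_ : w_val p 0 = 0%N) ?muln0.
Qed.

End Coef.
End Ghost.

(** * Lower convex hulls *)

Section Hull.
Variable R : realType.
Implicit Types (f q : nat -> \bar R) (x c A : R).

(* The height of [newton_polygon] over [x], as a function of the ordinates. *)
Definition hull f x : \bar R :=
  ereal_inf [set y | exists (m : nat) (a : 'I_m -> R) (n : 'I_m -> nat),
    [/\ forall i, 0 <= a i,
        \sum_i a i = 1,
        \sum_i a i * (n i)%:R = x &
        y = (\sum_i (a i)%:E * f (n i))%E]].

Lemma hull_le f m (a : 'I_m -> R) (n : 'I_m -> nat) :
    (forall i, 0 <= a i) -> \sum_i a i = 1 ->
  (hull f (\sum_i a i * (n i)%:R) <= \sum_i (a i)%:E * f (n i))%E.
Proof. by move=> a0 a1; apply: ereal_inf_lbound; exists m, a, n. Qed.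

Lemma hull_ge0 f x : (forall n, 0 <= f n)%E -> (0 <= hull f x)%E.
Proof.
move=> f0; apply: le_ereal_inf_tmp => _ [m [a [n [a0 _ _ ->]]]].
by apply: sume_ge0 => i _; rewrite mule_ge0 ?lee_fin.
Qed.

Lemma comb_affine q m (a : 'I_m -> R) (n l : 'I_m -> nat) A c :
    (forall i, 0 <= q i)%E -> \sum_i a i = 1 ->
  (\sum_i (a i)%:E * ((A + c * (n i)%:R)%:E + q (l i)) =
   (A + c * \sum_i a i * (n i)%:R)%:E + \sum_i (a i)%:E * q (l i))%E.
Proof.
move=> q0 a1; under eq_bigr do rewrite muleDr ?fin_num_adde_defr // -EFinM.
rewrite big_split /= sumEFin; congr (_%:E + _)%E.
rewrite -[A in RHS]mul1r -a1 mulr_suml mulr_sumr -big_split /=.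
by apply: eq_bigr => i _; ring.
Qed.

Lemma hull_le_shift f q (d : nat) A c x :
    (forall l, 0 <= q l)%E ->
    (forall l, f (d + l)%N <= (A + c * l%:R)%:E + q l)%E ->
  (hull f (d%:R + x) <= (A + c * x)%:E + hull q x)%E.
Proof.
move=> q0 fq; rewrite -leeBlDl //; apply: le_ereal_inf_tmp => _ [m [a [n [a0 a1 ax ->]]]].
rewrite leeBlDl // -[in X in (X%:E + _)%E]ax -comb_affine //.
have -> : d%:R + x = \sum_i a i * (d + n i)%N%:R.
  under eq_bigr do rewrite natrD mulrDr.
  by rewrite big_split /= -mulr_suml a1 mul1r ax.
apply: (le_trans (hull_le f (fun i => d + n i)%N a0 a1)).
by apply: lee_sum => i _; rewrite lee_wpmul2l ?lee_fin.
Qed.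

(* Shrinking the weights of a convex combination and giving the rest to the
   point at the origin lowers both the abscissa and the ordinate. *)
Lemma hull_le_scale q m (a : 'I_m -> R) (n : 'I_m -> nat) x :
    q 0%N = 0%E -> (forall l, 0 <= q l)%E ->
    (forall i, 0 <= a i) -> \sum_i a i = 1 ->
    0 <= x <= \sum_i a i * (n i)%:R ->
  (hull q x <= \sum_i (a i)%:E * q (n i))%E.
Proof.
move=> q00 q0 a0 a1 /andP[x0]; set X := \sum_i _ => xX.
(* If [X = 0] then [x = 0], and the convention [x / 0 = 0] gives an admissible ratio. *)
pose r := x / X.
have rX : r * X = x.
  rewrite /r; have [X0|X0] := eqVneq X 0; last by rewrite divfK.
  by rewrite X0 mulr0; apply/eqP; rewrite eq_le x0 -X0 xX.
have X0 : 0 <= X by exact: le_trans xX.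
have r01 : 0 <= r <= 1.
  rewrite /r divr_ge0 //=; have [X0'|X0'] := eqVneq X 0.
    by rewrite X0' invr0 mulr0.
  by rewrite ler_pdivrMr ?mul1r // lt_def X0' X0.
pose b (i : 'I_m.+1) := if unlift ord0 i is Some j then r * a j else 1 - r.
pose k (i : 'I_m.+1) := if unlift ord0 i is Some j then n j else 0%N.
have b0 i : 0 <= b i.
  by rewrite /b; case: unliftP => [j|] _; [rewrite mulr_ge0//|]; lra.
have b1 : \sum_i b i = 1.
  rewrite big_ord_recl /b unlift_none.
  under eq_bigr do rewrite liftK.
  by rewrite -mulr_sumr a1; lra.
have bx : \sum_i b i * (k i)%:R = x.
  rewrite big_ord_recl /b /k unlift_none mulr0 add0r.
  under eq_bigr do rewrite liftK -mulrA.
  by rewrite -mulr_sumr.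
rewrite -{1}bx; apply: (le_trans (hull_le q k b0 b1)).
rewrite big_ord_recl /b /k unlift_none q00 mule0 add0e.
apply: lee_sum => i _; rewrite liftK lee_wpmul2r // lee_fin.
by rewrite ler_piMl //; lra.
Qed.

(** The segment from the origin to [(N, f N)] bounds the hull from above. *)
Lemma hull_fin_num f (N : nat) x :
    f 0%N = 0%E -> (forall n, 0 <= f n)%E -> f N \is a fin_num ->
    0 <= x <= N%:R ->
  hull f x \is a fin_num.
Proof.
move=> f00 f0 fN xN; rewrite ge0_fin_numE ?hull_ge0 //.
have := @hull_le_scale f 1 (fun=> 1) (fun=> N) x f00 f0.
rewrite !big_ord1 mul1r mul1e => /(_ (fun=> ler01) erefl xN) /le_lt_trans; apply.
by rewrite -ge0_fin_numE.
Qed.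

(* The points [n] with [l n = 0] are moved to the abscissa [d] on the supporting
   line of slope [c]; the weights of the others are then shrunk. *)
Lemma hull_ge f q (l : nat -> nat) (d : nat) (sg : R) A c x :
    0 <= x -> q 0%N = 0%E -> (forall n, 0 <= q n)%E ->
    (forall n, sg * (n%:R - d%:R) <= (l n)%:R) -> sg ^+ 2 = 1 ->
    (forall n, (A + c * (n%:R - d%:R))%:E + q (l n) <= f n)%E ->
  ((A + c * (sg * x))%:E + hull q x <= hull f (d%:R + sg * x))%E.
Proof.
move=> x0 q00 q0 ln sg2 fq; apply: le_ereal_inf_tmp => _ [m [a [n [a0 a1 ax ->]]]].
(* [l n] is at least the signed distance [sg (n - d)], whose mean is [x] because [sg ^ 2 = 1]. *)
have xl : x <= \sum_i a i * (l (n i))%:R.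
  have -> : x = \sum_i a i * (sg * ((n i)%:R - d%:R)).
    under eq_bigr do rewrite mulrCA mulrBr.
    rewrite -mulr_sumr sumrB ax -mulr_suml a1 mul1r addrC addKr mulrA.
    by rewrite -expr2 sg2 mul1r.
  by apply: ler_sum => i _; rewrite ler_wpM2l.
have h : (hull q x <= \sum_i (a i)%:E * q (l (n i)))%E.
  by apply: hull_le_scale => //; rewrite x0.
apply: (le_trans (leeD2l _ h)).
have -> : A + c * (sg * x) = (A - c * d%:R) + c * (\sum_i a i * (n i)%:R).
  by rewrite ax; ring.
rewrite -comb_affine //; apply: lee_sum => i _; rewrite lee_wpmul2l ?lee_fin //.
apply: le_trans (fq (n i)); rewrite le_eqVlt; apply/orP; left; apply/eqP.
by congr (_%:E + _)%E; ring.
Qed.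

Lemma hull_line f (u w : nat) A c x :
    (forall n, (A + c * n%:R)%:E <= f n)%E ->
    f u = (A + c * u%:R)%:E -> f w = (A + c * w%:R)%:E ->
    u%:R <= x <= w%:R ->
  hull f x = (A + c * x)%:E.
Proof.
move=> fA fu fw xuw; apply/eqP; rewrite eq_le; apply/andP; split; last first.
  apply: le_ereal_inf_tmp => _ [m [a [n [a0 a1 ax ->]]]].
  have := @comb_affine (fun=> 0%E) m a n n A c (fun=> lexx _) a1.
  rewrite [X in (_ + X)%E]big1 => [|i _]; last by rewrite mule0.
  rewrite ax adde0 => <-; apply: lee_sum => i _.
  by rewrite lee_wpmul2l ?lee_fin // adde0.
have [uw|uw] := eqVneq (u%:R : R) w%:R.
  have xu : x = u%:R by rewrite -uw in xuw; lra.
  have := @hull_le f 1 (fun=> 1) (fun=> u) (fun=> ler01).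
  by rewrite !big_ord1 mul1r mul1e -xu fu -xu => /(_ erefl).
pose D : R := w%:R - u%:R.
have D0 : 0 < D by rewrite /D; have := uw; rewrite lt_def subr_eq0 eq_sym; lra.
pose a (i : 'I_2) := if i == ord0 then (w%:R - x) / D else (x - u%:R) / D.
pose n (i : 'I_2) := if i == ord0 then u else w.
have a0 i : 0 <= a i by rewrite /a; case: ifP => _; rewrite divr_ge0 //; lra.
have D0' : D != 0 by rewrite gt_eqF.
have a1 : \sum_i a i = 1.
  rewrite big_ord_recl big_ord1 /a /= -mulrDl; apply: (mulIf D0').
  by rewrite divfK // mul1r /D; ring.
have ax : \sum_i a i * (n i)%:R = x.
  rewrite big_ord_recl big_ord1 /a /n /=; rewrite /D in D0' *; field.
  exact: D0'.
have := hull_le f n a0 a1; rewrite ax => /le_trans; apply.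
have f0 : f (n ord0) = (A + c * (n ord0)%:R)%:E := fu.
have f1 : f (n (lift ord0 ord0)) = (A + c * (n (lift ord0 ord0))%:R)%:E := fw.
rewrite big_ord_recl big_ord1 f0 f1 -!EFinM -EFinD lee_fin.
have <- : A * \sum_i a i + c * \sum_i a i * (n i)%:R = A + c * x.
  by rewrite a1 ax mulr1.
by rewrite !big_ord_recl !big_ord0; lra.
Qed.

End Hull.

(** * Newton polygons of the ghost series *)

Section GhostHeights.
Variables (p : nat) (R : realType) (K : closedFieldType) (v : K -> \bar R).
Hypotheses (p_prime : prime p) (p_ge11 : (11 <= p)%N) (CpK : is_Cp p v).

Definition height (s k : int) (n : nat) : \bar R :=
  v (ghost p v s (w_ p v k) n).

Let vs (s k : int) (n : nat) : R := (val_sum p s k n)%:R.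

Let p_gt2 : (2 < p)%N. Proof. by lia. Qed.

Lemma height_ge0 s k n : 0 <= s -> s <= p%:Z - 2 -> (0 <= height s k n)%E.
Proof.
move=> s_ge0 s_le.
have [[x x0 [-> m]]|h] := pselect (exists2 x, 0 <= x & k = wt p s x /\ (0 < ghost_mult p s n k)%N).
  by rewrite /height v_ghost_inf ?leey.
rewrite /height v_ghost_fin ?lee_fin // => x x0 kx.
by apply/eqP; rewrite -leqn0 leqNgt; apply/negP => m; apply: h; exists x.
Qed.

Lemma height0 s k : 0 <= s -> s <= p%:Z - 2 -> height s k 0 = 0%E.
Proof.
move=> s_ge0 s_le; rewrite /height v_ghost_fin ?val_sum0 // => x x0 ->.
by rewrite ghost_mult0n.
Qed.

Section Weight.
Variables (s s2 k0 : int) (d : nat).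
Hypotheses (s_ge0 : 0 <= s) (s_le : s <= p%:Z - 2).
Hypotheses (s2_ge0 : 0 <= s2) (s2_le : s2 <= p%:Z - 2).
Hypothesis k0E : k0 = 2 + (p%:Z - 1) * (d%:Z - 1) + s + s2.
Hypothesis k0_ge2 : 2 <= k0.

Let c : R := (k0 - 1)%:~R.

(** [2 - k0 <= 0] is below every weight with [x >= 0], so no factor vanishes. *)
Lemma height_dual n :
  height (p%:Z - 2 - s2) (2 - k0) n = (vs (p%:Z - 2 - s2) (2 - k0) n)%:E.
Proof.
rewrite /height v_ghost_fin //; try lia.
by move=> x x0; rewrite /wt; nia.
Qed.

Lemma height_noncentral n : s != s2 -> height s k0 n = (vs s k0 n)%:E.
Proof.
move=> s12; rewrite /height v_ghost_fin // => x x0 kx; case/eqP: s12.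
have : (p%:Z - 1) * (d%:Z - 1 - x) = s - s2 by move: kx; rewrite k0E /wt; lia.
by have [|] := lerP (d%:Z - 1 - x) 0; have [|] := lerP 0 (d%:Z - 1 - x); nia.
Qed.

Lemma central_wt : s = s2 -> k0 = wt p s (d%:Z - 1).
Proof. by move=> s12; rewrite k0E /wt -s12; ring. Qed.

Lemma ghost_mult_central (n : nat) : s = s2 ->
  (0 < ghost_mult p s n k0)%N =
  (d_ur p s k0 < n%:Z) && (n%:Z < d%:Z - d_ur p s k0).
Proof.
move=> s12; have kw := central_wt s12; rewrite /ghost_mult.
have -> : d_Iw p s k0 = d by rewrite kw d_Iw_wt //; lia.
by case: ifP => // /andP[h1 h2]; rewrite absz_gt0 gt_eqF // lt_min; lia.
Qed.

Lemma height_central_fin (n : nat) : s = s2 ->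
    ~~ ((d_ur p s k0 < n%:Z) && (n%:Z < d%:Z - d_ur p s k0)) ->
  height s k0 n = (vs s k0 n)%:E.
Proof.
move=> s12; rewrite -ghost_mult_central // -leqNgt leqn0 => /eqP m0.
by rewrite /height v_ghost_fin.
Qed.

Lemma height_central_inf (n : nat) : s = s2 ->
    (d_ur p s k0 < n%:Z) && (n%:Z < d%:Z - d_ur p s k0) ->
  height s k0 n = +oo%E.
Proof.
move=> s12; rewrite -ghost_mult_central // central_wt // => m0.
rewrite /height v_ghost_inf //; have [d0|] := posnP d; last by lia.
by move: m0; rewrite d0 ghost_mult_lt0.
Qed.

Lemma d_ur_ge0_central : s = s2 -> 0 <= d_ur p s k0.
Proof.
move=> s12; have := @d_ur_leE_central p s s2 d p_gt2 s_ge0 s_le s12 (-1).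
by rewrite -k0E; lia.
Qed.

Lemma height_ge_Iw (n : nat) : (d <= n)%N -> height s k0 n = (vs s k0 n)%:E.
Proof.
move=> dn; have [s12|s12] := eqVneq s s2; last exact: height_noncentral.
by apply: height_central_fin => //; have := d_ur_ge0_central s12; lia.
Qed.

Lemma vs_theta l :
  vs s k0 (d + l) = vs s k0 d + c * l%:R + vs (p%:Z - 2 - s2) (2 - k0) l.
Proof.
have := val_sum_theta d p_prime p_gt2 s_ge0 s_le s2_ge0 s2_le l.
rewrite -k0E => /(congr1 (fun z : int => z%:~R : R)).
by rewrite !rmorphD rmorphM /= -!pmulrn.
Qed.

(** Dropping the nonnegative correction gives one inequality for both cases. *)
Lemma vs_atkin_lehner_le n : (n <= d)%N ->
  vs s k0 d + c * (n%:R - d%:R) + vs s2 k0 (d - n) <= vs s k0 n.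
Proof.
move=> nd; have := val_sum_atkin_lehner p_prime p_gt2 s_ge0 s_le s2_ge0 s2_le (subnKC nd).
rewrite -k0E => h.
have : (val_sum p s k0 d)%:Z + (val_sum p s2 k0 (d - n))%:Z <=
  (val_sum p s k0 n)%:Z + (k0 - 1) * (d - n)%N%:Z.
  by rewrite h; case: ifP => _; rewrite ?addr0 // lerDl le_max lexx.
rewrite -(ler_int R) !rmorphD rmorphM /= -!pmulrn natrB // -/c.
by rewrite /vs; lra.
Qed.

Lemma vs_ge0 t k n : 0 <= vs t k n.
Proof. exact: ler0n. Qed.

Lemma height_ge_affine n : (d <= n)%N ->
  height s k0 n = ((vs s k0 d + c * (n%:R - d%:R))%:E
    + height (p%:Z - 2 - s2) (2 - k0) (n - d))%E.
Proof.
move=> dn; rewrite height_dual (height_ge_Iw dn) -EFinD.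
by rewrite -{1}(subnKC dn) vs_theta natrB.
Qed.

End Weight.

Section Slopes.
Variables (s s2 k0 : int) (d : nat).
Hypotheses (s_ge0 : 0 <= s) (s_le : s <= p%:Z - 2).
Hypotheses (s2_ge0 : 0 <= s2) (s2_le : s2 <= p%:Z - 2).
Hypothesis k0E : k0 = 2 + (p%:Z - 1) * (d%:Z - 1) + s + s2.
Hypothesis k0_ge2 : 2 <= k0.

Let c : R := (k0 - 1)%:~R.

Let k0E' : k0 = 2 + (p%:Z - 1) * (d%:Z - 1) + s2 + s.
Proof. by rewrite k0E; ring. Qed.

Let sd_ge0 : 0 <= p%:Z - 2 - s2. Proof. by lia. Qed.
Let sd_le : p%:Z - 2 - s2 <= p%:Z - 2. Proof. by lia. Qed.

(** From [d] on, this is the theta equality; before [d], where [n - d] is truncated to 0,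
    Atkin-Lehner puts the points above the line of slope [k0 - 1]. *)
Lemma height_theta n :
  ((vs s k0 d + c * (n%:R - d%:R))%:E + height (p%:Z - 2 - s2) (2 - k0) (n - d)
   <= height s k0 n)%E.
Proof.
have [dn|nd] := leqP d n.
  by rewrite (height_ge_affine s_ge0 s_le s2_ge0 s2_le k0E k0_ge2 dn) lexx.
have /eqP -> : (n - d == 0)%N by rewrite subn_eq0 ltnW.
rewrite height0 // adde0.
have h := vs_atkin_lehner_le s_ge0 s_le s2_ge0 s2_le k0E (ltnW nd).
have := vs_ge0 s2 k0 (d - n); rewrite -/c in h => h0.
have h1 : vs s k0 d + c * (n%:R - d%:R) <= vs s k0 n by lra.
have [s12|s12] := eqVneq s s2; last first.
  by rewrite (height_noncentral s_ge0 s_le s2_ge0 s2_le k0E k0_ge2) // lee_fin.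
have [m|m] := boolP ((d_ur p s k0 < n%:Z) && (n%:Z < d%:Z - d_ur p s k0)).
  by rewrite (height_central_inf s_ge0 s_le s2_ge0 s2_le k0E k0_ge2 s12 m) leey.
by rewrite (height_central_fin s_ge0 s_le s2_ge0 s2_le k0E k0_ge2 s12 m) lee_fin.
Qed.

(** Before [d], if [s = s2], the points strictly between [d_ur] and [d - d_ur] are at infinity; this
    range is stable under [n -> d - n], so outside it both heights are finite. *)
Lemma height_atkin_lehner n :
  ((vs s k0 d + c * (n%:R - d%:R))%:E + height s2 k0 (d - n) <= height s k0 n)%E.
Proof.
have [dn|nd] := leqP d n.
  have /eqP -> : (d - n == 0)%N by rewrite subn_eq0.
  rewrite height0 //; apply: le_trans (height_theta n).
  by rewrite leeD2l // height_ge0.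
have h := vs_atkin_lehner_le s_ge0 s_le s2_ge0 s2_le k0E (ltnW nd).
rewrite -/c in h.
have [s12|s12] := eqVneq s s2; last first.
  rewrite (height_noncentral s_ge0 s_le s2_ge0 s2_le k0E k0_ge2) //.
  rewrite (height_noncentral s2_ge0 s2_le s_ge0 s_le k0E' k0_ge2) 1?eq_sym //.
have [m|m] := boolP ((d_ur p s k0 < n%:Z) && (n%:Z < d%:Z - d_ur p s k0)).
  by rewrite (height_central_inf s_ge0 s_le s2_ge0 s2_le k0E k0_ge2 s12 m) leey.
rewrite (height_central_fin s_ge0 s_le s2_ge0 s2_le k0E k0_ge2 s12 m) -s12.
rewrite (height_central_fin (n := d - n) s_ge0 s_le s2_ge0 s2_le k0E k0_ge2 s12); last by lia.
by rewrite lee_fin; rewrite -s12 in h.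
Qed.

Lemma hull_theta x : 0 <= x ->
  hull (height s k0) (d%:R + x) =
  ((vs s k0 d + c * x)%:E + hull (height (p%:Z - 2 - s2) (2 - k0)) x)%E.
Proof.
move=> x0; apply/eqP; rewrite eq_le; apply/andP; split.
  apply: hull_le_shift => l; first exact: height_ge0.
  rewrite (height_ge_affine s_ge0 s_le s2_ge0 s2_le k0E k0_ge2 (leq_addr l d)).
  by rewrite addKn natrD addrAC subrr add0r lexx.
rewrite -[in X in (_ <= X)%E](mul1r x) -[in X in (X%:E + _)%E](mul1r x).
apply: (hull_ge (l := fun n => (n - d)%N)) => //.
- exact: height0.
- by move=> n; exact: height_ge0.
- move=> n; rewrite mul1r; have [dn|nd] := leqP d n; first by rewrite natrB.
  by apply: (@le_trans _ _ 0) => //; rewrite subr_le0 ler_nat ltnW.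
- by rewrite expr1n.
- exact: height_theta.
Qed.

(** Equality is obtained later: for [s != s2] by exchanging the two characters, and for [s = s2],
    [x <= d_ur], by a separate upper bound. *)
Lemma hull_atkin_lehner_ge x : 0 <= x ->
  ((vs s k0 d - c * x)%:E + hull (height s2 k0) x
   <= hull (height s k0) (d%:R - x))%E.
Proof.
move=> x0; rewrite -[in X in (_ <= X)%E](mulN1r x) -mulrN -mulN1r.
apply: (hull_ge (l := fun n => (d - n)%N)) => //.
- exact: height0.
- by move=> n; exact: height_ge0.
- move=> n; rewrite mulN1r opprB; have [dn|nd] := leqP n d; first by rewrite natrB.
  by apply: (@le_trans _ _ 0) => //; rewrite subr_le0 ler_nat ltnW.
- by rewrite sqrrN expr1n.
- exact: height_atkin_lehner.
Qed.

Lemma vs_atkin_lehner_noncentral : s != s2 -> vs s k0 d + vs s2 k0 d = c * d%:R.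
Proof.
move=> s12.
have := val_sum_atkin_lehner p_prime p_gt2 s_ge0 s_le s2_ge0 s2_le (add0n d).
rewrite -k0E (negbTE s12) addr0 val_sum0 // add0r.
move=> /(congr1 (fun z : int => z%:~R : R)).
by rewrite !rmorphD rmorphM /= -!pmulrn.
Qed.

Lemma height_fin_num n : (d <= n)%N -> height s k0 n \is a fin_num.
Proof.
by move=> dn; rewrite (height_ge_Iw s_ge0 s_le s2_ge0 s2_le k0E k0_ge2).
Qed.

Lemma hull_height_fin_num x : 0 <= x -> hull (height s k0) x \is a fin_num.
Proof.
move=> x0; have [N Nx] : exists N : nat, x <= N%:R.
  by exists (Num.bound x); apply: ltW; apply: le_lt_trans (archi_boundP x0).
apply: (@hull_fin_num _ _ (d + N)); rewrite ?height0 ?x0 //.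
- by move=> n; exact: height_ge0.
- by rewrite height_fin_num ?leq_addr.
- by rewrite natrD; apply: (le_trans Nx); rewrite lerDr.
Qed.

Lemma hull_dual_fin_num x : 0 <= x ->
  hull (height (p%:Z - 2 - s2) (2 - k0)) x \is a fin_num.
Proof.
move=> x0; have := hull_height_fin_num (x := d%:R + x).
rewrite hull_theta // fin_numD => /(_ _)/andP[] //.
by rewrite addr_ge0.
Qed.

End Slopes.
End GhostHeights.

(** * The Newton polygon at a weight with [s = s2] *)

Section CentralWeight.
Variables (p : nat) (R : realType) (K : closedFieldType) (v : K -> \bar R).
Hypotheses (p_prime : prime p) (p_ge11 : (11 <= p)%N) (CpK : is_Cp p v).
Variables (s k0 : int) (d u : nat).
Hypotheses (s_ge0 : 0 <= s) (s_le : s <= p%:Z - 2).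
Hypothesis k0E : k0 = 2 + (p%:Z - 1) * (d%:Z - 1) + s + s.
Hypothesis k0_ge2 : 2 <= k0.
Hypothesis uE : d_ur p s k0 = u%:Z.

Let c : R := (k0 - 1)%:~R.
Let g : R := (k0 - 2)%:~R / 2.
Let vs (n : nat) : R := (val_sum p s k0 n)%:R.

Let uE' : d_ur p s (2 + (p%:Z - 1) * (d%:Z - 1) + s + s) = u%:Z.
Proof. by rewrite -k0E. Qed.

Let cE : c = g * 2 + 1.
Proof. by rewrite /c /g divfK // -[1]/(1%:~R) -rmorphD /=; congr (_%:~R); ring. Qed.

Lemma ur_double_le : (2 * u <= d)%N.
Proof. exact: (d_ur_double_le p_prime p_ge11 s_ge0 s_le uE'). Qed.

Lemma vs_le_ur n : (n <= u)%N -> vs u - vs n <= g * (u%:R - n%:R).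
Proof.
move=> nu; have := val_sum_le_ur p_prime p_ge11 s_ge0 s_le uE' nu.
rewrite -k0E -(ler_int R) !rmorphM !rmorphB /= -!pmulrn -/(vs _) -/(vs _).
by rewrite /g rmorphB /=; lra.
Qed.

Lemma vs_dual m : (u <= m <= d - u)%N ->
  vs (d - m) - vs m = g * (d%:R - 2 * m%:R).
Proof.
move=> mP; have := val_sum_dual p_prime p_ge11 s_ge0 s_le uE' mP.
rewrite -k0E => /(congr1 (fun z : int => z%:~R : R)).
rewrite !rmorphM !rmorphB !rmorphM /= -!pmulrn -/(vs _) -/(vs _).
by rewrite /g rmorphB /=; lra.
Qed.

Lemma vs_atkin_lehner_ur n : (n <= u)%N ->
  vs (d - n) - vs (d - u) = vs n - vs u + c * (u%:R - n%:R).
Proof.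
move=> nu; have := val_sum_atkin_lehner_ur p_prime p_ge11 s_ge0 s_le uE' nu.
rewrite -k0E => /(congr1 (fun z : int => z%:~R : R)).
rewrite rmorphB !rmorphD rmorphM !rmorphB /= -!pmulrn -!/(vs _) => ->.
by rewrite /c rmorphB; lra.
Qed.

Lemma vs_ge_Iw l : (g + 1) * l%:R <= vs (d - u + l) - vs (d - u).
Proof.
have := val_sum_ge_Iw p_prime p_ge11 s_ge0 s_le uE' l.
rewrite -k0E => /(_ k0_ge2).
rewrite -(ler_int R) !(rmorphM, rmorphB) /= -!pmulrn -/(vs _) -/(vs _).
by rewrite /g rmorphB /=; lra.
Qed.

Lemma height_outside n : (n <= u)%N || (d - u <= n)%N ->
  height p v s k0 n = (vs n)%:E.
Proof.
move=> nu; rewrite (height_central_fin _ _ _ s_ge0 s_le s_ge0 s_le k0E) // uE.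
by have := ur_double_le; lia.
Qed.

Lemma height_inside n : ~~ ((n <= u)%N || (d - u <= n)%N) ->
  height p v s k0 n = +oo%E.
Proof.
move=> nu; rewrite (height_central_inf _ _ _ s_ge0 s_le s_ge0 s_le k0E) // uE.
by have := ur_double_le; lia.
Qed.

(** Before [u] the increments are at most [g] on average; the point at [d - u] is on the line by
    duality at [m = u], and after it the points rise with slope at least [g + 1]. *)
Lemma height_ge_central n : ((vs u + g * (n%:R - u%:R))%:E <= height p v s k0 n)%E.
Proof.
have [nu|nu] := boolP ((n <= u)%N || (d - u <= n)%N); last first.
  by rewrite height_inside ?leey.
rewrite height_outside // lee_fin; case/orP: nu => nu.
  by have := vs_le_ur nu; lra.
have := vs_ge_Iw (n - (d - u)); rewrite subnKC // natrB //.
have ud := ur_double_le.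
have uu : (u <= u <= d - u)%N by lia.
have := vs_dual uu; rewrite natrB; last by lia.
have : d%:R <= n%:R + u%:R :> R by rewrite -natrD ler_nat; lia.
by lra.
Qed.

Lemma hull_new x : u%:R <= x <= (d - u)%N%:R ->
  hull (height p v s k0) x = (vs u + g * (x - u%:R))%:E.
Proof.
move=> ux; have ud := ur_double_le.
rewrite (@hull_line R _ u (d - u) (vs u - g * u%:R) g) //.
- by congr (_%:E); ring.
- move=> n; apply: le_trans (height_ge_central n).
  by rewrite lee_fin le_eqVlt; apply/orP; left; apply/eqP; ring.
- by rewrite height_outside ?leqnn //; congr (_%:E); ring.
rewrite height_outside ?leqnn ?orbT //; congr (_%:E).
have uu : (u <= u <= d - u)%N by lia.
by have := vs_dual uu; rewrite natrB; [lra | lia].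
Qed.

Lemma hull_atkin_lehner_ur x : 0 <= x <= u%:R ->
  hull (height p v s k0) (d%:R - x) =
  ((vs d - c * x)%:E + hull (height p v s k0) x)%E.
Proof.
move=> /andP[x0 xu]; have ud := ur_double_le.
apply/eqP; rewrite eq_le; apply/andP; split; last first.
  exact: (hull_atkin_lehner_ge p_prime p_ge11 CpK s_ge0 s_le s_ge0 s_le k0E).
(* The excess of the points after [d - u] over the line of slope [g + 1]. By Atkin-Lehner, for
   [l <= u], it is also the excess of the point at [u - l] over the line of slope [g]; the hull of
   [q] thus links the two ends of the polygon. *)
pose q (l : nat) : \bar R := (vs (d - u + l) - vs (d - u) - (g + 1) * l%:R)%:E.
have q0 l : (0 <= q l)%E by rewrite /q lee_fin; have := vs_ge_Iw l; lra.
have h1 : (hull (height p v s k0) ((d - u)%N%:R + (u%:R - x)) <=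
    (vs (d - u) + (g + 1) * (u%:R - x))%:E + hull q (u%:R - x))%E.
  apply: hull_le_shift => // l; rewrite height_outside ?leq_addr ?orbT //.
  by rewrite /q -EFinD lee_fin; lra.
have h2 : ((vs u + g * (-1 * (u%:R - x)))%:E + hull q (u%:R - x) <=
    hull (height p v s k0) (u%:R + -1 * (u%:R - x)))%E.
  apply: (hull_ge (l := fun n => (u - n)%N)) => //.
  - by rewrite subr_ge0.
  - by rewrite /q addn0 subrr mulr0 subr0.
  - move=> n; rewrite mulN1r opprB; have [dn|nd] := leqP n u; first by rewrite natrB.
    by apply: (@le_trans _ _ 0) => //; rewrite subr_le0 ler_nat ltnW.
  - by rewrite sqrrN expr1n.
  move=> n; have [nu|nu] := leqP n u; last first.
    have /eqP -> : (u - n == 0)%N by rewrite subn_eq0 ltnW.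
    rewrite /q addn0 subrr mulr0 subr0 adde0; exact: height_ge_central.
  rewrite height_outside ?nu // -EFinD lee_fin.
  have := vs_atkin_lehner_ur nu; have -> : (d - n = d - u + (u - n))%N by lia.
  by rewrite natrB // cE; lra.
have xE : u%:R + -1 * (u%:R - x) = x by ring.
have dxE : (d - u)%N%:R + (u%:R - x) = d%:R - x.
  by rewrite natrB; [ring | lia].
rewrite xE in h2; rewrite dxE in h1; apply: (le_trans h1).
apply: (@le_trans _ _ ((vs d - c * x)%:E +
   ((vs u + g * (-1 * (u%:R - x)))%:E + hull q (u%:R - x)))%E); last first.
  by rewrite leeD2l.
rewrite addeA leeD2r // -EFinD lee_fin.
have vs00 : vs 0 = 0 by rewrite /vs val_sum0 //; lia.
by have := vs_atkin_lehner_ur (leq0n u); rewrite subn0 vs00 cE; lra.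
Qed.

End CentralWeight.

(** * From heights to slopes *)

Lemma addeB_EFin (R : realType) (a b : R) (X Y : \bar R) :
    X \is a fin_num -> Y \is a fin_num ->
  ((a%:E + X) - (b%:E + Y) = (a - b)%:E + (X - Y))%E.
Proof.
by case: X Y => [x| |] [y| |] //= _ _; rewrite -!EFinD; congr (_%:E); ring.
Qed.

(** Reflection sends the step from [y] to [y + 1] to that from [n - (y + 1)] to [n - y]; finiteness
    of [H2] lets its values cancel. *)
Lemma slope_symmetric (R : realType) (H1 H2 : R -> \bar R) (n A c y : R) :
    H1 (n - y) = ((A - c * y)%:E + H2 y)%E ->
    H1 (n - (y + 1)) = ((A - c * (y + 1))%:E + H2 (y + 1)%R)%E ->
    H2 y \is a fin_num -> H2 (y + 1) \is a fin_num ->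
  ((H1 (n - y)%R - H1 (n - (y + 1))%R) + (H2 (y + 1)%R - H2 y) = c%:E)%E.
Proof.
move=> -> ->; case: (H2 y) (H2 (y + 1)%R) => [x| |] [z| |] //= _ _.
by rewrite -!EFinD; congr (_%:E); ring.
Qed.

Lemma newton_slopeE (p : nat) (R : realType) (K : closedFieldType)
    (v : K -> \bar R) (s k l : int) :
  newton_slope v (ghost p v s (w_ p v k)) l =
  (hull (height p v s k) l%:~R - hull (height p v s k) (l - 1)%:~R)%E.
Proof. by []. Qed.

Theorem proposition3p10 (p : nat) (p_prime : prime p) (p_ge11 : (11 <= p)%N)
    (R : realType) (K : closedFieldType) (v : K -> \bar R) (CpK : is_Cp p v)
    (s : int) (s_ge0 : 0 <= s) (s_le : s <= p%:Z - 2)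
    (k0 : int) (k0_ge2 : 2 <= k0) :
  let d : int := ((k0 - 2 - s) %/ (p%:Z - 1))%Z + 1 in
  let s' : int := res p (s + 1 - k0) in
  let s'' : int := res p (k0 - 2 - s) in
  let slope (t k l : int) : \bar R := newton_slope v (ghost p v t (w_ p v k)) l in
  let dIw : int := d_Iw p s k0 in
  let dur : int := d_ur p s k0 in
  let dnew : int := d_new p s k0 in
  let val_hat (n : int) : \bar R := v (ghost_coef_hat p v s n k0).[w_ p v k0] in
  [/\ chi_of p v s \* omega_char p v (k0 - 1) (1 - k0)
        = chi_of p v s',
      forall l : int, 1 <= l ->
        slope s k0 (d + l) = (((k0 - 1)%:~R)%R%:E + slope s' (2 - k0)%R l)%E,
      (k0 <> k_chi p s %[mod p%:Z - 1])%Z ->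
        forall l : int, 1 <= l <= d ->
          (slope s k0 l + slope s'' k0 (d - l + 1)%R)%E = (k0 - 1)%:~R%:E,
      (k0 = k_chi p s %[mod p%:Z - 1])%Z ->
        chi_of p v s'' = chi_of p v s /\
        forall l : int, 1 <= l <= dur ->
          (slope s k0 l + slope s k0 (d - l + 1)%R)%E = (k0 - 1)%:~R%:E &
      (k0 = k_chi p s %[mod p%:Z - 1])%Z ->
        (forall j : int, 0 <= j <= dnew ->
          (val_hat (dIw - dur - j)%R - val_hat (dur + j)%R)%E
            = ((k0 - 2)%:~R * (dnew%:~R / 2 - j%:~R))%:E) /\
        (forall l : int, dur < l <= dIw - dur ->
          slope s k0 l = ((k0 - 2)%:~R / 2)%:E)].
Proof.
move=> d s' s2 slope dIw dur dnew val_hat.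
have p0 : 0 < p%:Z - 1 by lia.
have s2_ge0 : 0 <= s2 by apply: modz_ge0; lia.
have s2_le : s2 <= p%:Z - 2.
  by have : s2 < p%:Z - 1 by [exact: ltz_pmod]; lia.
have kE : k0 - 2 - s = (d - 1) * (p%:Z - 1) + s2.
  by rewrite /d addrK; exact: divz_eq.
have d0 : 0 <= d by nia.
(* [s + 1 - k0 = -(k0 - 2 - s) - 1], hence the complementary residue. *)
have s'E : s' = p%:Z - 2 - s2.
  rewrite /s' /res.
  have -> : s + 1 - k0 = (- d) * (p%:Z - 1) + (p%:Z - 2 - s2) by lia.
  by rewrite modzMDl modz_small //; lia.
(* Modulo [p - 1], [k0] is [2 + s + s2] and [k_chi] is [2 + 2s]; both exponents are reduced
   residues. *)
have central : (k0 = k_chi p s %[mod p%:Z - 1])%Z <-> s = s2.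
  have -> : k0 = (d - 1) * (p%:Z - 1) + (2 + s + s2) by lia.
  rewrite k_chiE //; last by lia.
  have -> : 2 + 2 * s - (p%:Z - 1) * delta_chi p s =
    (- delta_chi p s) * (p%:Z - 1) + (2 + s + s) by ring.
  rewrite !modzMDl; split=> [/eqP|<- //].
  rewrite eqz_mod_dvd => /dvdzP[q qE].
  have {}qE : s2 - s = q * (p%:Z - 1) by lia.
  have q0 : q = 0 by nia.
  by move: qE; rewrite q0; lia.
have [n dE] : exists n : nat, d = n by exists `|d|%N; rewrite gez0_abs.
have k0E : k0 = 2 + (p%:Z - 1) * (n%:Z - 1) + s + s2 by rewrite -dE; lia.
have k0E2 : k0 = 2 + (p%:Z - 1) * (n%:Z - 1) + s2 + s by rewrite -dE; lia.
have theta x := @hull_theta p R K v p_prime p_ge11 CpK s s2 k0 n s_ge0 s_le s2_ge0 s2_le k0E k0_ge2 x.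
have AL1 x := @hull_atkin_lehner_ge p R K v p_prime p_ge11 CpK s s2 k0 n s_ge0 s_le s2_ge0 s2_le k0E k0_ge2 x.
have AL2 x := @hull_atkin_lehner_ge p R K v p_prime p_ge11 CpK s2 s k0 n s2_ge0 s2_le s_ge0 s_le k0E2 k0_ge2 x.
have fin1 x := @hull_height_fin_num p R K v p_prime p_ge11 CpK s s2 k0 n s_ge0 s_le s2_ge0 s2_le k0E k0_ge2 x.
have fin2 x := @hull_height_fin_num p R K v p_prime p_ge11 CpK s2 s k0 n s2_ge0 s2_le s_ge0 s_le k0E2 k0_ge2 x.
have fin' x := @hull_dual_fin_num p R K v p_prime p_ge11 CpK s s2 k0 n s_ge0 s_le s2_ge0 s2_le k0E k0_ge2 x.
have dR : d%:~R = n%:R :> R by rewrite dE.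
split.
- exact: chi_of_twist.
- move=> l l1; have l0 : (0 : R) <= (l - 1)%:~R by rewrite ler0z; lia.
  have l0' : (0 : R) <= l%:~R by rewrite ler0z; lia.
  have e1 : (d + l)%:~R = n%:R + l%:~R :> R by rewrite rmorphD /= dR.
  have e2 : (d + l - 1)%:~R = n%:R + (l - 1)%:~R :> R by rewrite -addrA rmorphD /= dR.
  rewrite /slope !newton_slopeE s'E e1 e2 !theta // addeB_EFin ?fin' //.
  by congr (_%:E + _)%E; rewrite rmorphB /=; ring.
- move=> nc; have s12 : s != s2 by apply/eqP => /central.
  (* The upper bound is the inequality for [s2] at [n - x]; the two constants add up to
     [(k0 - 1) n]. *)
  have AL x : 0 <= x <= n%:R -> hull (height p v s k0) (n%:R - x) =
      (((val_sum p s k0 n)%:R - (k0 - 1)%:~R * x)%:E + hull (height p v s2 k0) x)%E.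
    move=> /andP[x0 xn]; apply/eqP; rewrite eq_le AL1 // andbT.
    have xn' : 0 <= n%:R - x by lra.
    have := AL2 _ xn'; rewrite subKr.
    rewrite -(leeD2lE _ _ (x := ((val_sum p s k0 n)%:R - (k0 - 1)%:~R * x)%:E)) //.
    apply: le_trans; rewrite addeA -EFinD.
    have := @vs_atkin_lehner_noncentral p R p_prime p_ge11 s s2 k0 n s_ge0 s_le s2_ge0 s2_le k0E s12.
    move=> h; rewrite -[leLHS]add0e leeD2r // lee_fin.
    by lra.
  move=> l /andP[l1 ld]; rewrite /slope !newton_slopeE.
  have l0 : (0 : R) <= (d - l)%:~R by rewrite ler0z; lia.
  have l1R : (1 : R) <= l%:~R by rewrite (ler_int R 1); lia.
  have -> : d - l + 1 - 1 = d - l by ring.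
  have -> : (d - l + 1)%:~R = (d - l)%:~R + 1 :> R by rewrite rmorphD.
  have -> : (l - 1)%:~R = n%:R - ((d - l)%:~R + 1) :> R.
    by rewrite -dR !rmorphB /=; ring.
  have lE : l%:~R = n%:R - (d - l)%:~R :> R by rewrite -dR rmorphB /=; ring.
  rewrite {1}lE; move: (_%:~R) l0 l1R lE => y y0 l1R lE.
  by apply: slope_symmetric; [apply: AL | apply: AL | apply: fin2 | apply: fin2]; lra.
- move/central => s12; split; first by rewrite s12.
  have k0Ec := k0E; rewrite -s12 in k0Ec.
  have [u uE] : exists u : nat, dur = u.
    have := @d_ur_ge0_central p p_prime p_ge11 s s2 k0 n s_ge0 s_le s2_ge0 s2_le k0E k0_ge2 s12.
    by exists `|dur|%N; rewrite gez0_abs.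
  have AL x := @hull_atkin_lehner_ur p R K v p_prime p_ge11 CpK s k0 n u s_ge0 s_le k0Ec k0_ge2 uE x.
  move=> l /andP[l1 lu]; rewrite /slope !newton_slopeE.
  have l1R : (0 : R) <= (l - 1)%:~R by rewrite ler0z; lia.
  have luR : l%:~R <= u%:R :> R by rewrite pmulrn ler_int -uE.
  have lE : l%:~R = (l - 1)%:~R + 1 :> R by rewrite rmorphB /= subrK.
  have -> : (d - l + 1)%:~R = n%:R - (l - 1)%:~R :> R.
    by rewrite -dR -rmorphB /=; congr (_%:~R); ring.
  have -> : (d - l + 1 - 1)%:~R = n%:R - ((l - 1)%:~R + 1) :> R.
    by rewrite -lE -dR -rmorphB /=; congr (_%:~R); ring.
  (* The reflected step, numbered [d - l + 1], has to come first. *)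
  rewrite addeC lE; move: (_%:~R) l1R lE luR => y y0 lE luR.
  by apply: slope_symmetric; [apply: AL | apply: AL | apply: fin1 | apply: fin1]; lra.
- move=> /central s12.
  have k0Ec := k0E; rewrite -s12 in k0Ec.
  have [u uE] : exists u : nat, dur = u.
    have := @d_ur_ge0_central p p_prime p_ge11 s s2 k0 n s_ge0 s_le s2_ge0 s2_le k0E k0_ge2 s12.
    by exists `|dur|%N; rewrite gez0_abs.
  have kw : k0 = wt p s (n%:Z - 1) by rewrite k0Ec /wt; ring.
  have ud := @ur_double_le p p_prime p_ge11 s k0 n u s_ge0 s_le k0Ec uE.
  have IwE : dIw = n by rewrite /dIw kw d_Iw_wt //; lia.
  have newE : dnew = n%:Z - 2 * u%:Z by rewrite /dnew /d_new -/dIw -/dur IwE uE.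
  have hatE (m : nat) : val_hat m%:Z = (val_sum p s k0 m)%:R%:E.
    by rewrite /val_hat kw v_ghost_hat //; lia.
  split=> [j /andP[j0 jn]|l /andP[ul lu]].
    (* With [m = u + |j|] the two indices are [d - m] and [m]. *)
    have -> : dIw - dur - j = (n - (u + `|j|))%N%:Z by rewrite IwE uE; lia.
    have -> : dur + j = (u + `|j|)%N%:Z by rewrite uE; lia.
    have mP : (u <= u + `|j| <= n - u)%N by lia.
    rewrite !hatE -EFinB (@vs_dual p R p_prime p_ge11 s k0 n u s_ge0 s_le k0Ec uE _ mP).
    have jE : j%:~R = `|j|%N%:R :> R by rewrite pmulrn gez0_abs.
    have nE : dnew%:~R = n%:R - 2 * u%:R :> R.
      by rewrite newE rmorphB rmorphM /= -!pmulrn.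
    by congr (_%:E); rewrite nE jE natrD; field.
  have new x := @hull_new p R K v p_prime p_ge11 CpK s k0 n u s_ge0 s_le k0Ec k0_ge2 uE x.
  rewrite /slope newton_slopeE.
  have lE : l%:~R = (l - 1)%:~R + 1 :> R by rewrite rmorphB /= subrK.
  have l1 : u%:R <= (l - 1)%:~R :> R by rewrite pmulrn ler_int; lia.
  have l2 : l%:~R <= (n - u)%N%:R :> R by rewrite pmulrn ler_int; lia.
  rewrite !new -?EFinB; [|by rewrite l1; lra|by rewrite l2; lra].
  by congr (_%:E); rewrite lE; ring.
Qed.
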